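(* Let $\alpha>1$, $\delta\in(0,\alpha-1)$, $\tau\in(0,\alpha-1-\delta]$, $d\in\mathbb N$, $1\ge\gamma_1\ge\dots\ge\gamma_d>0$, and $g\in H_{\alpha,\boldsymbol\gamma,d}$. Let $\boldsymbol x_1,\dots,\boldsymbol x_N\in[0,1]^d$, $c_1,\dots,c_N\in\mathbb R$. Let $L$ be a prime and $\mathcal Z=\{\boldsymbol z_0,\dots,\boldsymbol z_{L-1}\}$ a rank-1 lattice point set of size $L$ satisfying $e(H_{\beta,\boldsymbol\gamma,d},\mathcal Z)\le C_{\boldsymbol\gamma,d}(\beta,\tau')L^{-\beta+\tau'}$ for all $\tau'\in(0,\beta-\frac12]$, where $\beta=\alpha-\frac12-\delta$. Then for $\nu>1$, with $K=R^\alpha_{\nu,\boldsymbol\gamma,d}$, $$\mathrm{err}_1(g,\mathcal C)+\mathrm{err}_2(g,\mathcal C)\lesssim\|g\|_{H_{\alpha,\boldsymbol\gamma,d}}\Big(\frac1{\nu^{\frac12-\frac1{4\alpha}}}+\frac{\nu^{(\frac12+\frac1{4\alpha})d}}{L^{\alpha-\frac12-\delta-\tau}}c_{\alpha,\boldsymbol\gamma,d}\,\zeta_{\delta,d}\,C_{\boldsymbol\gamma,d}\big(\alpha-\tfrac12-\delta,\tau\big)\Big)\overline\mu_N,$$ where the implicit constant depends on $d$, $\alpha$ and $(\gamma_j)_{j\in[d]}$.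
   Context: $r_\beta(\gamma,h)=\max(|h|^{2\beta}/\gamma,1)$, $r_\beta(\boldsymbol\gamma,\boldsymbol k)=\prod_jr_\beta(\gamma_j,k_j)$; $\omega_{\boldsymbol k}(\boldsymbol x)=\exp(2\pi i\,\boldsymbol k\cdot\boldsymbol x)$, $\widehat f_{\boldsymbol k}=\int_{[0,1]^d}f\,\overline{\omega_{\boldsymbol k}}$. Weighted Korobov space ($\beta>1/2$): $H_{\beta,\boldsymbol\gamma,d}=\{f\in L_2([0,1]^d):\|f\|_{H_{\beta,\boldsymbol\gamma,d}}=(\sum_{\boldsymbol k}r_\beta(\boldsymbol\gamma,\boldsymbol k)|\widehat f_{\boldsymbol k}|^2)^{1/2}<\infty\}$. $R^\alpha_{\nu,\boldsymbol\gamma,d}=\{\boldsymbol k\in\mathbb Z^d:\max_jr_\alpha(\gamma_j,k_j)\le\nu\}$. $\phi_K(\boldsymbol x)=\sum_{\boldsymbol k\in K}\check\phi_{\boldsymbol k}\overline{\omega_{\boldsymbol k}(\boldsymbol x)}$, $\check\phi_{\boldsymbol k}=\frac1N\sum_nc_n\omega_{\boldsymbol k}(\boldsymbol x_n)$; $\mathcal C=(c_n)$; $\mathrm{err}_1(g,\mathcal C)=|\frac1N\sum_nc_ng(\boldsymbol x_n)-\int g\phi_K|$, $\mathrm{err}_2(g,\mathcal C)=|\int g\phi_K-\frac1L\sum_\ell(g\phi_K)(\boldsymbol z_\ell)|$. Rank-1 lattice: $\{\boldsymbol z_\ell=(\ell\mathfrak g/L)\bmod1\}$, $\mathfrak g\in\{1,\dots,L-1\}^d$.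 $e(H_{\beta,\boldsymbol\gamma,d},\mathcal Z)=\sup_{\|f\|\le1}|\int f-\frac1L\sum_\ell f(\boldsymbol z_\ell)|$. $C_{\boldsymbol\gamma,d}(\beta,\tau)=2^{\beta-\tau}\prod_j[1+2\gamma_j^{1/(2(\beta-\tau))}\zeta(\frac\beta{\beta-\tau})]^{\beta-\tau}$; $\overline\mu_N=\frac1N\sum_n|c_n|$; $c_{\alpha,\boldsymbol\gamma,d}=\sqrt{\prod_j\max(1,2^{2\alpha}\gamma_j)}$; $\zeta_{\delta,d}=[1+2\zeta(1+2\delta)]^{d/2}$; $\zeta$ Riemann zeta. *)

(* Defs.v *)
From Stdlib Require Import Reals.
From Coquelicot Require Import Coquelicot.
From mathcomp Require Import ssreflect ssrbool ssrfun eqtype ssrnat seq choice.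
From mathcomp Require Import fintype div finfun bigop prime.

Set Implicit Arguments.
Unset Strict Implicit.

Local Open Scope R_scope.

Definition pt (d : nat) := 'I_d -> R.
Definition freq (d : nat) := 'I_d -> Z.

Definition Rleb (x y : R) : bool := if Rle_dec x y then true else false.

(* x^y for x >= 0 with the convention 0^y = 0 (y > 0) *)
Definition rpow (x y : R) : R := if Req_EM_T x 0 then 0 else Rpower x y.

Definition zeta (s : R) : R := Series (fun n => / Rpower (INR n.+1) s).

Definition Csum (I : finType) (P : pred I) (F : I -> C) : C :=
  \big[Cplus/RtoC 0]_(i | P i) F i.
Definition Rsum (I : finType) (F : I -> R) : R := \big[Rplus/0]_(i : I) F i.
Definition Rprod (d : nat) (F : 'I_d -> R) : R := \big[Rmult/1]_(j < d) F j.
Definition Rmaxj (d : nat) (F : 'I_d -> R) : R := \big[Rmax/0]_(j < d) F j.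

Definition kdot (d : nat) (k : freq d) (x : pt d) : R :=
  \big[Rplus/0]_(j < d) (IZR (k j) * x j).
Definition omega (d : nat) (k : freq d) (x : pt d) : C :=
  (cos (2 * PI * kdot k x), sin (2 * PI * kdot k x)).

Definition ext (d : nat) (x : pt d) (t : R) : pt d.+1 :=
  fun j => match unlift ord_max j with Some j' => x j' | None => t end.

(* integral over [0,1]^d (iterated Riemann integral; all integrands used
   below are continuous on the cube) *)
Fixpoint intd (d : nat) : (pt d -> C) -> C :=
  match d return (pt d -> C) -> C with
  | O => fun f => f (fun _ => 0)
  | S d' => fun f => @RInt C_R_CompleteNormedModule (fun t => @intd d' (fun y => f (ext y t))) 0 1
  end.

Definition fhat (d : nat) (f : pt d -> C) (k : freq d) : C :=
  @intd d (fun x => Cmult (f x) (Cconj (omega k x))).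

Definition r1 (beta gam : R) (h : Z) : R :=
  Rmax (rpow (Rabs (IZR h)) (2 * beta) / gam) 1.
Definition rw (d : nat) (beta : R) (gam : 'I_d -> R) (k : freq d) : R :=
  Rprod (fun j => r1 beta (gam j) (k j)).

(* box {k : |k_j| <= M} enumerated by finite functions *)
Definition boxk (d M : nat) (u : {ffun 'I_d -> 'I_(2 * M).+1}) : freq d :=
  fun j => (Z.of_nat (u j) - Z.of_nat M)%Z.

(* unordered sum over Z^d of a nonnegative family (sup of box sums) *)
Definition sumZd (d : nat) (F : freq d -> R) : Rbar :=
  Lub_Rbar (fun s => exists M : nat,
    s = Rsum (fun u : {ffun 'I_d -> 'I_(2 * M).+1} => F (boxk u))).

Definition in_cube (d : nat) (x : pt d) : Prop := forall j, 0 <= x j <= 1.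
Definition cont_cube (d : nat) (f : pt d -> C) : Prop :=
  forall x, in_cube x -> forall eps, 0 < eps -> exists delta, 0 < delta /\
    forall y, in_cube y -> (forall j, Rabs (y j - x j) < delta) ->
      Cmod (Cminus (f y) (f x)) < eps.

(* weighted Korobov space H_{beta,gamma,d} (elements identified with their
   continuous representatives) and its norm *)
Definition normH2 (d : nat) (beta : R) (gam : 'I_d -> R) (f : pt d -> C) : Rbar :=
  sumZd (fun k => rw beta gam k * (Cmod (fhat f k)) ^ 2).
Definition inH (d : nat) (beta : R) (gam : 'I_d -> R) (f : pt d -> C) : Prop :=
  cont_cube f /\ is_finite (normH2 beta gam f).
Definition normH (d : nat) (beta : R) (gam : 'I_d -> R) (f : pt d -> C) : R :=
  sqrt (real (normH2 beta gam f)).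

Definition inK (d : nat) (alpha nu : R) (gam : 'I_d -> R) (k : freq d) : bool :=
  Rleb (Rmaxj (fun j => r1 alpha (gam j) (k j))) nu.
(* a box radius containing K: k in K implies |k_j| <= (nu gamma_j)^(1/(2 alpha)) *)
Definition Kbox (d : nat) (alpha nu : R) (gam : 'I_d -> R) : nat :=
  Z.to_nat (up (Rmaxj (fun j => Rpower (nu * gam j) (/ (2 * alpha))))).
Definition sumK (d : nat) (alpha nu : R) (gam : 'I_d -> R) (F : freq d -> C) : C :=
  Csum (fun u : {ffun 'I_d -> 'I_(2 * Kbox alpha nu gam).+1} =>
          inK alpha nu gam (boxk u))
       (fun u => F (boxk u)).

Definition phicheck (d N : nat) (xs : 'I_N -> pt d) (c : 'I_N -> R) (k : freq d) : C :=
  Cmult (RtoC (/ INR N)) (Csum predT (fun n => Cmult (RtoC (c n)) (omega k (xs n)))).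
Definition phiK (d N : nat) (alpha nu : R) (gam : 'I_d -> R)
  (xs : 'I_N -> pt d) (c : 'I_N -> R) (x : pt d) : C :=
  sumK alpha nu gam (fun k => Cmult (phicheck xs c k) (Cconj (omega k x))).

Definition zlat (d L : nat) (gen : 'I_d -> nat) (l : 'I_L) : pt d :=
  fun j => INR ((l * gen j) %% L)%N / INR L.

Definition Qlat (d L : nat) (gen : 'I_d -> nat) (f : pt d -> C) : C :=
  Cmult (RtoC (/ INR L)) (Csum predT (fun l : 'I_L => f (zlat gen l))).

Definition err1 (d N : nat) (alpha nu : R) (gam : 'I_d -> R)
  (xs : 'I_N -> pt d) (c : 'I_N -> R) (g : pt d -> C) : R :=
  Cmod (Cminus
    (Cmult (RtoC (/ INR N)) (Csum predT (fun n => Cmult (RtoC (c n)) (g (xs n)))))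
    (@intd d (fun x => Cmult (g x) (phiK alpha nu gam xs c x)))).

Definition err2 (d N L : nat) (alpha nu : R) (gam : 'I_d -> R)
  (xs : 'I_N -> pt d) (c : 'I_N -> R) (gen : 'I_d -> nat) (g : pt d -> C) : R :=
  Cmod (Cminus (@intd d (fun x => Cmult (g x) (phiK alpha nu gam xs c x)))
               (Qlat L gen (fun x => Cmult (g x) (phiK alpha nu gam xs c x)))).

Definition wce (d L : nat) (beta : R) (gam : 'I_d -> R) (gen : 'I_d -> nat) : Rbar :=
  Lub_Rbar (fun e => exists f : pt d -> C,
    inH beta gam f /\ normH beta gam f <= 1 /\
    e = Cmod (Cminus (@intd d f) (Qlat L gen f))).

Definition Cgd (d : nat) (gam : 'I_d -> R) (beta tau : R) : R :=
  Rpower 2 (beta - tau) *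
  Rprod (fun j => Rpower (1 + 2 * Rpower (gam j) (/ (2 * (beta - tau)))
                               * zeta (beta / (beta - tau))) (beta - tau)).

Definition mubar (N : nat) (c : 'I_N -> R) : R := / INR N * Rsum (fun n => Rabs (c n)).

Definition cagd (d : nat) (alpha : R) (gam : 'I_d -> R) : R :=
  sqrt (Rprod (fun j => Rmax 1 (Rpower 2 (2 * alpha) * gam j))).

Definition zetadd (delta : R) (d : nat) : R :=
  Rpower (1 + 2 * zeta (1 + 2 * delta)) (INR d / 2).

(* Main.v *)
(** The sup norm of a continuous f on the cube is at most the l1 norm of its Fourier
    coefficients: in dimension one by Fejer means at interior points and continuity at
    the endpoints, in general by induction on the dimension, slicing off the last
    coordinate.  Applied to g minus its Fourier sum over K, this and Cauchy-Schwarz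
    reduce err_1 to the sum of 1/r_alpha(k) over k outside K, which is
    O(nu^(1/(2 alpha) - 1)) because some coordinate exceeds (nu gamma_j)^(1/(2 alpha)).

    For err_2, the k-th Fourier coefficient of g phi_K is the sum over l in K of
    phi_l g^_(k+l).  Cauchy-Schwarz over K, the quasi-submultiplicativity
    r_beta(k) <= 2^(2 alpha d) r_beta(k+l) r_beta(l), the bound
    r_beta(l) <= C nu^(d (1 - 1/(2 alpha))) on K (as beta <= alpha - 1/2) and
    |K| = O(nu^(d/(2 alpha))) give
    ||g phi_K||_beta <= C nu^(d (1/2 + 1/(4 alpha))) ||g||_alpha mubar, and the worst-case
    error of the lattice rule finishes; c_(alpha,gamma,d) and zeta_(delta,d) enter only
    through being at least 1. *)
Require Import Defs.
From Stdlib Require Import Reals ZArith Lra Lia Classical ClassicalEpsilon FunctionalExtensionality.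
From Coquelicot Require Import Coquelicot.
From HB Require Import structures.
From mathcomp Require Import ssreflect ssrbool ssrfun eqtype ssrnat seq choice.
From mathcomp Require Import fintype div finfun bigop prime.
From mathcomp Require Import zify.

Set Implicit Arguments.
Unset Strict Implicit.

Local Open Scope R_scope.

Local Arguments INR : simpl never.

(** The constant is fixed before [delta] and [tau], hence before [beta]. That is why the weight
    comparisons use 2^(2 alpha) instead of 2^(2 beta) and, of [beta], only 0 < beta <= alpha - 1/2;
    the gamma_j enter the constant through negative powers. The size of K enters the squared norm of
    g phi_K twice, through Cauchy-Schwarz in l and as the number of shifts summed over. Per
    coordinate this gives nu^(2/(2 alpha)) nu^(1 - 1/(2 alpha)) = nu^(1 + 1/(2 alpha)), whose root
    is the exponent of the statement. No infinite sum over Z^d is formed: norms are suprema of box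
    sums, so each estimate lives on one finite box, and a box that is shifted or extended by a
    coordinate is embedded injectively in a larger one. Integrals are iterated Riemann integrals, so
    linearity is available only for continuous integrands, and every slice or partial integral must
    first be shown continuous. *)

HB.instance Definition _ := Monoid.isComLaw.Build R 0 Rplus
  (fun x y z => esym (Rplus_assoc x y z)) Rplus_comm Rplus_0_l.
HB.instance Definition _ := Monoid.isComLaw.Build R 1 Rmult
  (fun x y z => esym (Rmult_assoc x y z)) Rmult_comm Rmult_1_l.
HB.instance Definition _ := Monoid.isMulLaw.Build R 0 Rmult Rmult_0_l Rmult_0_r.
HB.instance Definition _ := Monoid.isAddLaw.Build R Rmult Rplus
  (fun x y z => Rmult_plus_distr_r x y z) Rmult_plus_distr_l.
HB.instance Definition _ := Monoid.isComLaw.Build C (RtoC 0) Cplus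
  Cplus_assoc Cplus_comm Cplus_0_l.
HB.instance Definition _ := Monoid.isMulLaw.Build C (RtoC 0) Cmult Cmult_0_l Cmult_0_r.
HB.instance Definition _ := Monoid.isAddLaw.Build C Cmult Cplus
  (fun x y z => Cmult_plus_distr_r x y z) Cmult_plus_distr_l.

(** * Finite sums and products of real and complex numbers *)

Lemma big_Rplus_le (I : Type) (r : seq I) (P : pred I) (F G : I -> R) :
  (forall i, P i -> F i <= G i) ->
  \big[Rplus/0]_(i <- r | P i) F i <= \big[Rplus/0]_(i <- r | P i) G i.
Proof. by move=> h; apply: (big_ind2 Rle) => //; [lra | move=> *; lra]. Qed.

Lemma big_Rplus_ge0 (I : Type) (r : seq I) (P : pred I) (F : I -> R) :
  (forall i, P i -> 0 <= F i) -> 0 <= \big[Rplus/0]_(i <- r | P i) F i.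
Proof. by move=> h; apply: (big_ind (Rle 0)) => //; [lra | move=> *; lra]. Qed.

Lemma big_Rmult_ge0 (I : Type) (r : seq I) (P : pred I) (F : I -> R) :
  (forall i, P i -> 0 <= F i) -> 0 <= \big[Rmult/1]_(i <- r | P i) F i.
Proof. by move=> h; apply: (big_ind (Rle 0)) => //; [lra | move=> *; nra]. Qed.

Lemma big_Rmult_ge1 (I : Type) (r : seq I) (P : pred I) (F : I -> R) :
  (forall i, P i -> 1 <= F i) -> 1 <= \big[Rmult/1]_(i <- r | P i) F i.
Proof. by move=> h; apply: (big_ind (Rle 1)) => //; [lra | move=> *; nra]. Qed.

Lemma big_Rmult_gt0 (I : Type) (r : seq I) (P : pred I) (F : I -> R) :
  (forall i, P i -> 0 < F i) -> 0 < \big[Rmult/1]_(i <- r | P i) F i.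
Proof. by move=> h; apply: (big_ind (Rlt 0)) => //; [lra | move=> *; nra]. Qed.

Lemma big_Rmult_le (I : Type) (r : seq I) (P : pred I) (F G : I -> R) :
  (forall i, P i -> 0 <= F i <= G i) ->
  \big[Rmult/1]_(i <- r | P i) F i <= \big[Rmult/1]_(i <- r | P i) G i.
Proof.
move=> h; suff: 0 <= \big[Rmult/1]_(i <- r | P i) F i
  <= \big[Rmult/1]_(i <- r | P i) G i by case.
apply: (big_ind2 (fun x y => 0 <= x <= y)) => //; first lra.
by move=> x1 x2 y1 y2 ? ?; nra.
Qed.

Lemma iter_Rplus (n : nat) (x : R) : iter n (Rplus x) 0 = INR n * x.
Proof.
elim: n => [|n IH]; first by change (INR 0) with 0; rewrite /=; ring.
by rewrite iterS IH S_INR; ring.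
Qed.

Lemma iter_Rmult (n : nat) (x : R) : iter n (Rmult x) 1 = x ^ n.
Proof. by elim: n => [|n IH] //; rewrite iterS IH. Qed.

Lemma big_Rplus_const (I : finType) (x : R) :
  \big[Rplus/0]_(i : I) x = INR #|I| * x.
Proof. by rewrite big_const iter_Rplus. Qed.

(** Serves every passage from one frequency box into a larger one. *)
Lemma big_Rplus_inj_le (I J : finType) (h : I -> J) (F : J -> R) :
  injective h -> (forall j, 0 <= F j) ->
  \big[Rplus/0]_i F (h i) <= \big[Rplus/0]_j F j.
Proof.
move=> hinj F0.
have -> : \big[Rplus/0]_i F (h i) = \big[Rplus/0]_(j <- [seq h i | i <- enum I]) F j.
  by rewrite big_map enumT.
rewrite big_uniq /=; last by rewrite map_inj_uniq ?enum_uniq.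
rewrite [X in _ <= X](bigID (mem [seq h i | i <- enum I])) /=.
rewrite -[X in X <= _]Rplus_0_r; apply: Rplus_le_compat_l.
by apply: big_Rplus_ge0.
Qed.

Lemma big_Rplus_pred_le (I : finType) (P : pred I) (F : I -> R) :
  (forall i, 0 <= F i) -> \big[Rplus/0]_(i | P i) F i <= \big[Rplus/0]_i F i.
Proof.
move=> F0; rewrite [X in _ <= X](bigID P) /=.
have := @big_Rplus_ge0 I (index_enum I) (fun i => ~~ P i) F (fun j _ => F0 j); lra.
Qed.

(** Induction on the list, with the nonnegativity of both sums of squares carried along. The step
    needs y b^2 + z a^2 - 2 x a b >= 0: multiplied by y > 0 it equals (y b - x a)^2 + a^2 (y z -
    x^2), and y = 0 forces x = 0. *)
Lemma cauchy_schwarz_sum (I : Type) (r : seq I) (P : pred I) (a b : I -> R) :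
  (\big[Rplus/0]_(i <- r | P i) (a i * b i)) ^ 2 <=
  \big[Rplus/0]_(i <- r | P i) (a i ^ 2) * \big[Rplus/0]_(i <- r | P i) (b i ^ 2).
Proof.
pose Q x y z := [/\ 0 <= y, 0 <= z & x ^ 2 <= y * z].
suff [] : Q (\big[Rplus/0]_(i <- r | P i) (a i * b i))
   (\big[Rplus/0]_(i <- r | P i) (a i ^ 2))
   (\big[Rplus/0]_(i <- r | P i) (b i ^ 2)) by [].
elim/big_rec3: _ => [|i z y x _ [y0 z0 h]]; first by split; lra.
split; [nra | nra |].
suff h2 : 0 <= y * b i ^ 2 + z * a i ^ 2 - 2 * x * a i * b i by nra.
case: y0 => [y0|y0]; last first.
  have -> : x = 0 by move: h; rewrite -y0; nra.
  rewrite -y0; nra.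
apply: (Rmult_le_reg_l y) => //; rewrite Rmult_0_r.
apply: (Rle_trans _ ((y * b i - x * a i) ^ 2)); first exact: pow2_ge_0.
nra.
Qed.

Lemma Cmod_big_le (I : Type) (r : seq I) (P : pred I) (F : I -> C) :
  Cmod (\big[Cplus/RtoC 0]_(i <- r | P i) F i) <= \big[Rplus/0]_(i <- r | P i) Cmod (F i).
Proof.
apply: (big_ind2 (fun x y => Cmod x <= y)) => [|x1 x2 y1 y2 h1 h2|i _].
- rewrite Cmod_0; lra.
- apply: Rle_trans (Cmod_triangle _ _) _; lra.
- lra.
Qed.

Lemma Cconj_big (I : Type) (r : seq I) (P : pred I) (F : I -> C) :
  Cconj (\big[Cplus/RtoC 0]_(i <- r | P i) F i) =
  \big[Cplus/RtoC 0]_(i <- r | P i) Cconj (F i).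
Proof.
apply: (big_morph Cconj) => [x y|].
- by rewrite /Cconj /Cplus /=; congr pair; ring.
- by rewrite /Cconj /=; congr pair; ring.
Qed.

Lemma iter_Cplus1 (n : nat) : iter n (Cplus (RtoC 1)) (RtoC 0) = RtoC (INR n).
Proof.
elim: n => [|n IH] //; rewrite iterS IH S_INR /RtoC /Cplus /=.
by congr pair; ring.
Qed.

(** * Riemann integrals of continuous complex functions on [0,1] *)

Lemma norm_Cmod (z : C) : @norm R_AbsRing C_R_CompleteNormedModule z = Cmod z.
Proof.
rewrite /norm /Cmod /= /prod_norm /norm /= /abs /=.
by congr sqrt; rewrite !Rmult_1_r -!Rabs_mult !Rabs_pos_eq //; nra.
Qed.

Notation CRInt f := (@RInt C_R_CompleteNormedModule f 0 1).
Notation is_CRInt f l := (@is_RInt C_R_CompleteNormedModule f 0 1 l).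
Notation ex_CRInt f := (@ex_RInt C_R_CompleteNormedModule f 0 1).

Definition cont01 (h : R -> C) : Prop :=
  forall t, 0 <= t <= 1 -> forall eps, 0 < eps -> exists delta, 0 < delta /\
    forall s, 0 <= s <= 1 -> Rabs (s - t) < delta -> Cmod (Cminus (h s) (h t)) < eps.

(** Retraction of the line onto [0,1]. Composition with it turns continuity relative to the interval
    into two-sided continuity, endpoints included, as the integrability criterion requires. *)
Definition clamp (t : R) : R := Rmax 0 (Rmin 1 t).

Lemma clamp_bound (t : R) : 0 <= clamp t <= 1.
Proof. rewrite /clamp /Rmax /Rmin; repeat case: Rle_dec; lra. Qed.

Lemma clamp_id (t : R) : 0 <= t <= 1 -> clamp t = t.
Proof. rewrite /clamp /Rmax /Rmin; repeat case: Rle_dec; lra. Qed.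

Lemma clamp_lipschitz (s t : R) : Rabs (clamp s - clamp t) <= Rabs (s - t).
Proof.
rewrite /clamp /Rmax /Rmin /Rabs; repeat case: Rle_dec; repeat case: Rcase_abs; lra.
Qed.

Lemma ex_CRInt_cont01 (h : R -> C) : cont01 h -> ex_CRInt h.
Proof.
move=> hc.
apply: (@ex_RInt_ext C_R_CompleteNormedModule (fun t => h (clamp t))).
  move=> x; rewrite Rmin_left ?Rmax_right; try lra.
  by move=> ?; rewrite clamp_id //; lra.
apply: ex_RInt_continuous => z _; apply/filterlim_locally => eps.
have [delta [d0 hd]] := hc _ (clamp_bound z) eps (cond_pos eps).
exists (mkposreal _ d0) => s hs.
apply: norm_compat1; rewrite norm_Cmod.
apply: hd; first exact: clamp_bound.
apply: Rle_lt_trans (clamp_lipschitz _ _) _; exact: hs.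
Qed.

Lemma is_CRInt_cont01 (h : R -> C) : cont01 h -> is_CRInt h (CRInt h).
Proof. by move=> /ex_CRInt_cont01 /RInt_correct. Qed.

(** The module structure on [C] is over the reals, so a complex factor is treated through real and
    imaginary parts. *)
Lemma is_CRInt_scal (h : R -> C) (c l : C) :
  is_CRInt h l -> is_CRInt (fun t => Cmult c (h t)) (Cmult c l).
Proof.
move=> hl.
have h1 := is_RInt_fct_extend_fst h 0 1 l hl.
have h2 := is_RInt_fct_extend_snd h 0 1 l hl.
apply: is_RInt_fct_extend_pair => /=.
- apply: is_RInt_minus; exact: is_RInt_scal.
- apply: is_RInt_plus; exact: is_RInt_scal.
Qed.

Lemma CRInt_scal (h : R -> C) (c : C) :
  cont01 h -> CRInt (fun t => Cmult c (h t)) = Cmult c (CRInt h).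
Proof. by move=> hc; apply: is_RInt_unique; apply: is_CRInt_scal; apply: is_CRInt_cont01. Qed.

Lemma CRInt_plus (h k : R -> C) : cont01 h -> cont01 k ->
  CRInt (fun t => Cplus (h t) (k t)) = Cplus (CRInt h) (CRInt k).
Proof.
move=> hc kc; apply: is_RInt_unique.
by apply: (@is_RInt_plus C_R_CompleteNormedModule); apply: is_CRInt_cont01.
Qed.

Lemma CRInt_bound (h : R -> C) (B : R) : cont01 h ->
  (forall t, 0 <= t <= 1 -> Cmod (h t) <= B) -> Cmod (CRInt h) <= B.
Proof.
move=> hc hB; rewrite -norm_Cmod.
have -> : B = scal (1 - 0) B by rewrite /scal /= /mult /=; ring.
apply: (@norm_RInt_le C_R_CompleteNormedModule h (fun _ => B) 0 1) => //; first lra.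
- by move=> x hx; rewrite norm_Cmod; apply: hB.
- exact: is_CRInt_cont01.
- exact: is_RInt_const.
Qed.

Lemma CRInt_ext (h k : R -> C) : (forall t, 0 <= t <= 1 -> h t = k t) -> CRInt h = CRInt k.
Proof.
move=> e; apply: RInt_ext => x; rewrite Rmin_left ?Rmax_right; try lra.
by move=> ?; apply: e; lra.
Qed.

(** * Slices of the cube and continuity on it *)

Lemma ext_lift (d : nat) (y : pt d) (t : R) (i : 'I_d) : ext y t (lift ord_max i) = y i.
Proof. by rewrite /ext liftK. Qed.

Lemma ext_max (d : nat) (y : pt d) (t : R) : ext y t ord_max = t.
Proof. by rewrite /ext unlift_none. Qed.

Lemma ext_eta (d : nat) (x : pt d.+1) :
  ext (fun i : 'I_d => x (lift ord_max i)) (x ord_max) = x.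
Proof.
apply: functional_extensionality => j.
by case: (unliftP ord_max j) => [i ->|->]; rewrite ?ext_lift ?ext_max.
Qed.

Lemma ext_cube (d : nat) (y : pt d) (t : R) :
  in_cube y -> 0 <= t <= 1 -> in_cube (ext y t).
Proof.
move=> hy ht j.
by case: (unliftP ord_max j) => [i ->|->]; rewrite ?ext_lift ?ext_max.
Qed.

Lemma in_cube0 (d : nat) : in_cube (fun _ : 'I_d => 0).
Proof. move=> j; lra. Qed.

Section ContinuousFunctions.
Variable d : nat.
Implicit Types f g : pt d -> C.

Lemma cont_cube_const (c : C) : cont_cube (fun _ : pt d => c).
Proof.
move=> x _ eps e0; exists 1; split=> [|y _ _]; first lra.
by rewrite /Cminus Cplus_opp_r Cmod_0.
Qed.

Lemma cont_cube_plus f g : cont_cube f -> cont_cube g ->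
  cont_cube (fun x => Cplus (f x) (g x)).
Proof.
move=> fc gc x hx eps e0.
have e2 : 0 < eps / 2 by lra.
have [d1 [p1 h1]] := fc x hx _ e2; have [d2 [p2 h2]] := gc x hx _ e2.
exists (Rmin d1 d2); split=> [|y hy hxy]; first exact: Rmin_pos.
have -> : Cminus (Cplus (f y) (g y)) (Cplus (f x) (g x)) =
  Cplus (Cminus (f y) (f x)) (Cminus (g y) (g x)) by ring.
apply: Rle_lt_trans (Cmod_triangle _ _) _.
have := h1 y hy (fun j => Rlt_le_trans _ _ _ (hxy j) (Rmin_l _ _)).
have := h2 y hy (fun j => Rlt_le_trans _ _ _ (hxy j) (Rmin_r _ _)).
lra.
Qed.

Lemma cont_cube_mult f g : cont_cube f -> cont_cube g ->
  cont_cube (fun x => Cmult (f x) (g x)).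
Proof.
move=> fc gc x hx eps e0.
set A := Cmod (f x); set B := Cmod (g x).
have A0 : 0 <= A by exact: Cmod_ge_0.
have B0 : 0 <= B by exact: Cmod_ge_0.
(* With both increments below e <= 1, the three-term expansion of the difference is at most e (1 + A
   + B) < eps. *)
set e := Rmin 1 (eps / (A + B + 2)).
have q0 : 0 < eps / (A + B + 2) by apply: Rdiv_lt_0_compat; lra.
have ep : 0 < e by apply: Rmin_pos; lra.
have [d1 [p1 h1]] := fc x hx _ ep; have [d2 [p2 h2]] := gc x hx _ ep.
exists (Rmin d1 d2); split=> [|y hy hxy]; first exact: Rmin_pos.
have -> : Cminus (Cmult (f y) (g y)) (Cmult (f x) (g x)) =
  Cplus (Cplus (Cmult (Cminus (f y) (f x)) (Cminus (g y) (g x)))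
               (Cmult (f x) (Cminus (g y) (g x))))
        (Cmult (Cminus (f y) (f x)) (g x)) by ring.
apply: Rle_lt_trans (Cmod_triangle _ _) _.
apply: Rle_lt_trans (Rplus_le_compat_r _ _ _ (Cmod_triangle _ _)) _.
rewrite !Cmod_mult -/A -/B.
have a1 := h1 y hy (fun j => Rlt_le_trans _ _ _ (hxy j) (Rmin_l _ _)).
have a2 := h2 y hy (fun j => Rlt_le_trans _ _ _ (hxy j) (Rmin_r _ _)).
have b1 := Cmod_ge_0 (Cminus (f y) (f x)); have b2 := Cmod_ge_0 (Cminus (g y) (g x)).
have e1 : e <= 1 by exact: Rmin_l.
have e2 : e <= eps / (A + B + 2) by exact: Rmin_r.
have e3 : e * (A + B + 2) <= eps.
  have := Rmult_le_compat_r (A + B + 2) _ _ ltac:(lra) e2.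
  by rewrite /Rdiv Rmult_assoc Rinv_l; lra.
nra.
Qed.

Lemma cont_cube_conj f : cont_cube f -> cont_cube (fun x => Cconj (f x)).
Proof.
move=> fc x hx eps e0; have [d1 [p1 h1]] := fc x hx _ e0.
exists d1; split=> // y hy hxy.
have -> : Cminus (Cconj (f y)) (Cconj (f x)) = Cconj (Cminus (f y) (f x)).
  by rewrite /Cconj /Cminus /Cplus /Copp /=; congr pair; ring.
by rewrite Cmod_conj; apply: h1.
Qed.

Lemma cont_cube_big (I : Type) (r : seq I) (P : pred I) (F : I -> pt d -> C) :
  (forall i, cont_cube (F i)) ->
  cont_cube (fun x => \big[Cplus/RtoC 0]_(i <- r | P i) F i x).
Proof.
move=> Fc; elim: r => [|i r IH].
  have -> : (fun x => \big[Cplus/RtoC 0]_(i <- [::] | P i) F i x) = (fun _ => RtoC 0).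
    by apply: functional_extensionality => x; rewrite big_nil.
  exact: cont_cube_const.
case Pi : (P i).
  have -> : (fun x => \big[Cplus/RtoC 0]_(j <- i :: r | P j) F j x) =
     (fun x => Cplus (F i x) (\big[Cplus/RtoC 0]_(j <- r | P j) F j x)).
    by apply: functional_extensionality => x; rewrite big_cons Pi.
  exact: cont_cube_plus.
have -> // : (fun x => \big[Cplus/RtoC 0]_(j <- i :: r | P j) F j x) =
     (fun x => \big[Cplus/RtoC 0]_(j <- r | P j) F j x).
by apply: functional_extensionality => x; rewrite big_cons Pi.
Qed.

End ContinuousFunctions.

(** * Characters of the torus and uniform continuity *)

Definition expi (a : R) : C := (cos a, sin a).

Lemma expiD (a b : R) : expi (a + b) = Cmult (expi a) (expi b).
Proof. by rewrite /expi cos_plus sin_plus /Cmult /=; congr pair; ring. Qed.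

Lemma expi0 : expi 0 = RtoC 1.
Proof. by rewrite /expi cos_0 sin_0. Qed.

Lemma expiN (a : R) : expi (- a) = Cconj (expi a).
Proof. by rewrite /expi cos_neg sin_neg. Qed.

Lemma Cmod_expi (a : R) : Cmod (expi a) = 1.
Proof.
rewrite /Cmod /expi /=.
have -> : cos a * (cos a * 1) + sin a * (sin a * 1) = 1.
  have := sin2_cos2 a; rewrite /Rsqr; lra.
exact: sqrt_1.
Qed.

(** Chord length of the unit circle. It yields both the Lipschitz bound for characters and the decay
    of the Dirichlet kernel. *)
Lemma Cmod_expi_minus1 (a : R) : Cmod (Cminus (expi a) (RtoC 1)) ^ 2 = 4 * sin (a / 2) ^ 2.
Proof.
rewrite /Cmod -Rsqr_pow2 Rsqr_sqrt; last by apply: Rplus_le_le_0_compat; apply: pow2_ge_0.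
rewrite /expi /=.
have := sin2_cos2 a; rewrite /Rsqr.
have : cos a = 1 - 2 * sin (a / 2) * sin (a / 2).
  by rewrite -cos_2a_sin; congr cos; field.
move=> -> h.
have e : (1 - 2 * sin (a / 2) * sin (a / 2)) * (1 - 2 * sin (a / 2) * sin (a / 2)) =
  1 - sin a * sin a by lra.
nra.
Qed.

Lemma Cmod_expi_minus1_le (a : R) : Cmod (Cminus (expi a) (RtoC 1)) <= Rabs a.
Proof.
apply: Rsqr_incr_0_var; last exact: Rabs_pos.
rewrite -Rsqr_abs !Rsqr_pow2 Cmod_expi_minus1.
suff : Rabs (sin (a / 2)) <= Rabs (a / 2).
  move=> /Rsqr_le_abs_1; rewrite /Rsqr; nra.
wlog a0 : a / 0 <= a.
  move=> hw; case: (Rle_dec 0 a) => [|a0]; first exact: hw.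
  have := hw (- a) ltac:(lra).
  have -> : - a / 2 = - (a / 2) by field.
  by rewrite sin_neg !Rabs_Ropp.
rewrite (Rabs_pos_eq (a / 2)); last lra.
have s1 : forall b, 0 <= b -> sin b <= b.
  by move=> b [b0|<-]; [left; apply: sin_lt_x | rewrite sin_0; lra].
case: (Rle_dec (a / 2) PI) => h.
  rewrite Rabs_pos_eq; first by apply: s1; lra.
  by apply: sin_ge_0; lra.
have := SIN_bound (a / 2); have := PI2_1; move=> p [q1 q2].
have : Rabs (sin (a / 2)) <= 1 by apply: Rabs_le; lra.
lra.
Qed.

Lemma omega_expi (d : nat) (k : freq d) (x : pt d) : omega k x = expi (2 * PI * kdot k x).
Proof. by []. Qed.

Lemma Cmod_omega (d : nat) (k : freq d) (x : pt d) : Cmod (omega k x) = 1.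
Proof. exact: Cmod_expi. Qed.

Lemma omegaD (d : nat) (k l : freq d) (x : pt d) :
  omega (fun j => (k j + l j)%Z) x = Cmult (omega k x) (omega l x).
Proof.
rewrite !omega_expi -expiD; congr expi; rewrite -Rmult_plus_distr_l; congr Rmult.
rewrite /kdot -big_split /=; apply: eq_bigr => j _; rewrite plus_IZR; ring.
Qed.

Lemma omegaN (d : nat) (k : freq d) (x : pt d) :
  omega (fun j => (- k j)%Z) x = Cconj (omega k x).
Proof.
rewrite !omega_expi -expiN; congr expi; rewrite Ropp_mult_distr_r; congr Rmult.
apply: (Rplus_eq_reg_r (kdot k x)); rewrite Rplus_opp_l.
rewrite /kdot -big_split /=; apply: big1 => j _; rewrite opp_IZR; ring.
Qed.

Lemma omega_ext (d : nat) (k : freq d.+1) (y : pt d) (t : R) :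
  omega k (ext y t) =
  Cmult (omega (fun i : 'I_d => k (lift ord_max i)) y) (expi (2 * PI * (IZR (k ord_max) * t))).
Proof.
rewrite !omega_expi -expiD -Rmult_plus_distr_l; congr expi; congr Rmult.
rewrite /kdot big_ord_recr /= ext_max; congr Rplus; apply: eq_bigr => i _.
have -> : widen_ord (leqnSn d) i = lift ord_max i.
  by apply: val_inj; rewrite /= /bump leqNgt ltn_ord.
by rewrite ext_lift.
Qed.

Lemma cont_cube_omega (d : nat) (k : freq d) : cont_cube (omega k).
Proof.
move=> x hx eps e0.
set A := \big[Rplus/0]_(j < d) Rabs (IZR (k j)).
have A0 : 0 <= A by apply: big_Rplus_ge0 => j _; exact: Rabs_pos.
have P0 := PI_RGT_0.
have q0 : 0 < 2 * PI * (A + 1) by nra.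
exists (eps / (2 * PI * (A + 1))); split=> [|y hy hxy]; first exact: Rdiv_lt_0_compat.
set b := kdot k y - kdot k x.
have -> : Cminus (omega k y) (omega k x) =
   Cmult (omega k x) (Cminus (expi (2 * PI * b)) (RtoC 1)).
  rewrite !omega_expi.
  have -> : 2 * PI * kdot k y = 2 * PI * kdot k x + 2 * PI * b by rewrite /b; ring.
  by rewrite expiD; ring.
rewrite Cmod_mult Cmod_omega Rmult_1_l.
apply: Rle_lt_trans (Cmod_expi_minus1_le _) _.
rewrite Rabs_mult (Rabs_pos_eq (2 * PI)); last lra.
have hb : Rabs b <= A * (eps / (2 * PI * (A + 1))).
  rewrite /A big_distrl /=.
  have -> : b = \big[Rplus/0]_(j < d) (IZR (k j) * (y j - x j)).
    rewrite /b; apply: (Rplus_eq_reg_r (kdot k x)).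
    rewrite /kdot -big_split /= /Rminus Rplus_assoc Rplus_opp_l Rplus_0_r.
    by apply: eq_bigr => j _; ring.
  apply: Rle_trans (_ : \big[Rplus/0]_(j < d) Rabs (IZR (k j) * (y j - x j)) <= _).
    apply: (big_ind2 (fun u v => Rabs u <= v)) => [|u1 u2 v1 v2 h1 h2|j _].
    - rewrite Rabs_R0; lra.
    - apply: Rle_trans (Rabs_triang _ _) _; lra.
    - lra.
  apply: big_Rplus_le => j _; rewrite Rabs_mult.
  apply: Rmult_le_compat_l; [exact: Rabs_pos | left; exact: hxy].
apply: Rle_lt_trans (Rmult_le_compat_l _ _ _ _ hb) _; first lra.
have -> : 2 * PI * (A * (eps / (2 * PI * (A + 1)))) = eps * (A / (A + 1)) by field; lra.
have : A / (A + 1) < 1 by apply/Rlt_div_l; lra.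
nra.
Qed.

(* Lebesgue-number form of the compactness of the cube. *)
Lemma cube_compact (d : nat) (delta : pt d -> R) :
  (forall x, in_cube x -> 0 < delta x) ->
  exists eta, 0 < eta /\ forall x, in_cube x -> exists t, in_cube t /\
    (forall j, Rabs (x j - t j) < delta t) /\ eta <= delta t.
Proof.
elim: d delta => [|d IH] delta dpos.
  exists (delta (fun _ => 0)); split; first by apply: dpos; exact: in_cube0.
  move=> x hx; exists (fun _ => 0); split; first exact: in_cube0.
  by split=> [[] //|]; lra.
(* Tube argument: [e t] is a Lebesgue number of the slice at height [t], and it also serves as the
   gauge for compactness in the last coordinate. *)
have ex_eta : forall t, exists e : posreal, 0 <= t <= 1 -> forall y, in_cube y ->
   exists y', in_cube y' /\ (forall j, Rabs (y j - y' j) < delta (ext y' t)) /\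
     e <= delta (ext y' t).
  move=> t; case: (classic (0 <= t <= 1)) => [ht|ht]; last first.
    by exists (mkposreal 1 Rlt_0_1).
  have [y hy|e [e0 he]] := IH (fun y => delta (ext y t)).
    by apply: dpos; exact: ext_cube.
  by exists (mkposreal e e0).
have [e he] := ClassicalEpsilon.choice _ ex_eta.
have [eta heta] := compactness_value_1d 0 1 e.
exists eta; split; first exact: cond_pos.
move=> x hx.
have [t [ht [h1 h2]]] := NNPP _ (heta (x ord_max) (hx ord_max)).
have [y' [hy' [h3 h4]]] := he t ht (fun i => x (lift ord_max i)) (fun i => hx _).
exists (ext y' t); split; first exact: ext_cube.
split=> [j|]; last lra.
case: (unliftP ord_max j) => [i ->|->]; rewrite ?ext_lift ?ext_max; first exact: h3.
lra.
Qed.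

Lemma cont_cube_unif (d : nat) (f : pt d -> C) (eps : R) : cont_cube f -> 0 < eps ->
  exists eta, 0 < eta /\ forall x y, in_cube x -> in_cube y ->
    (forall j, Rabs (y j - x j) < eta) -> Cmod (Cminus (f y) (f x)) < eps.
Proof.
move=> fc e0.
(* Continuity is taken at radius 2 e: a centre within e of x and a y within eta <= e of x leave y
   within 2 e of that centre. *)
have ex_d : forall x, exists e, in_cube x -> 0 < e /\ forall y, in_cube y ->
    (forall j, Rabs (y j - x j) < 2 * e) -> Cmod (Cminus (f y) (f x)) < eps / 2.
  move=> x; case: (classic (in_cube x)) => [hx|hx]; last by exists 0.
  have [e [p he]] := fc x hx (eps / 2) ltac:(lra).
  exists (e / 2) => _; split; first lra.
  by move=> y hy h; apply: he => // j; have := h j; lra.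
have [e he] := ClassicalEpsilon.choice _ ex_d.
have [|eta [eta0 heta]] := @cube_compact d e; first by move=> x /he [].
exists eta; split=> // x y hx hy hxy.
have [t [ht [h1 h2]]] := heta x hx; have [t0 h3] := he t ht.
have a1 : Cmod (Cminus (f x) (f t)) < eps / 2.
  by apply: h3 => // j; have := h1 j; lra.
have a2 : Cmod (Cminus (f y) (f t)) < eps / 2.
  apply: h3 => // j; have := h1 j; have := hxy j.
  have -> : y j - t j = (y j - x j) + (x j - t j) by ring.
  have := Rabs_triang (y j - x j) (x j - t j); lra.
have -> : Cminus (f y) (f x) = Cplus (Cminus (f y) (f t)) (Copp (Cminus (f x) (f t))) by ring.
apply: Rle_lt_trans (Cmod_triangle _ _) _; rewrite Cmod_opp; lra.
Qed.

Lemma cont_cube_slice (d : nat) (f : pt d.+1 -> C) (t : R) :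
  cont_cube f -> 0 <= t <= 1 -> cont_cube (fun y => f (ext y t)).
Proof.
move=> fc ht y hy eps e0.
have [e [p he]] := fc _ (ext_cube hy ht) _ e0.
exists e; split=> // y' hy' h; apply: he; first exact: ext_cube.
move=> j; case: (unliftP ord_max j) => [i ->|->]; rewrite ?ext_lift ?ext_max //.
by rewrite Rminus_diag Rabs_R0.
Qed.

(** * The iterated integral *)

Definition intd_linear (d : nat) : Prop := forall (f g : pt d -> C) (a b : C),
  cont_cube f -> cont_cube g ->
  intd (fun x => Cplus (Cmult a (f x)) (Cmult b (g x))) =
  Cplus (Cmult a (intd f)) (Cmult b (intd g)).

Definition intd_bounded (d : nat) : Prop := forall (f : pt d -> C) (B : R),
  cont_cube f -> (forall x, in_cube x -> Cmod (f x) <= B) -> Cmod (intd f) <= B.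

(** By uniform continuity, slices at nearby heights are uniformly close; linearity makes the
    difference of their integrals one integral, and the sup bound makes it small. *)
Lemma intd_param_cont_aux (d : nat) (f : pt d.+1 -> C) :
  intd_linear d -> intd_bounded d -> cont_cube f ->
  cont01 (fun t => intd (fun y => f (ext y t))).
Proof.
move=> hl hb fc t ht eps e0.
have [eta [p he]] := cont_cube_unif fc (ltac:(lra) : 0 < eps / 2).
exists eta; split=> // s hs hst.
have -> : Cminus (intd (fun y => f (ext y s))) (intd (fun y => f (ext y t))) =
  Cplus (Cmult (RtoC 1) (intd (fun y => f (ext y s))))
    (Cmult (Copp (RtoC 1)) (intd (fun y => f (ext y t)))) by ring.
rewrite -hl; [|exact: cont_cube_slice | exact: cont_cube_slice].
apply: (Rle_lt_trans _ (eps / 2)); last lra.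
apply: hb.
  by apply: cont_cube_plus; apply: cont_cube_mult;
     try exact: cont_cube_const; exact: cont_cube_slice.
move=> y hy; left.
have -> : Cplus (Cmult (RtoC 1) (f (ext y s))) (Cmult (Copp (RtoC 1)) (f (ext y t))) =
  Cminus (f (ext y s)) (f (ext y t)) by ring.
apply: he; [exact: ext_cube | exact: ext_cube | move=> j].
case: (unliftP ord_max j) => [i ->|->]; rewrite ?ext_lift ?ext_max //.
by rewrite Rminus_diag Rabs_R0.
Qed.

Lemma intd_ext (d : nat) (f g : pt d -> C) :
  (forall x, in_cube x -> f x = g x) -> intd f = intd g.
Proof.
elim: d f g => [|d IH] f g e /=; first by apply: e; exact: in_cube0.
by apply: CRInt_ext => t ht; apply: IH => y hy; apply: e; exact: ext_cube.
Qed.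

Lemma cont01_mult_const (h : R -> C) (c : C) : cont01 h -> cont01 (fun t => Cmult c (h t)).
Proof.
move=> hc t ht eps e0.
have c0 := Cmod_ge_0 c.
have [e [p he]] := hc t ht (eps / (Cmod c + 1)) ltac:(apply: Rdiv_lt_0_compat; lra).
exists e; split=> // s hs hst; have := he s hs hst.
have -> : Cminus (Cmult c (h s)) (Cmult c (h t)) = Cmult c (Cminus (h s) (h t)) by ring.
rewrite Cmod_mult => /Rlt_div_r; have := Cmod_ge_0 (Cminus (h s) (h t)); nra.
Qed.

(** One induction for both properties: in dimension d + 1 the outer integral can be handled only
    once the inner one is continuous in the outer variable, and that continuity rests on both
    properties in dimension d. *)
Lemma intd_linear_bounded (d : nat) : intd_linear d /\ intd_bounded d.
Proof.
elim: d => [|d [IHl IHb]].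
  by split=> [f g a b _ _ //|f B _ h]; apply: h; exact: in_cube0.
split=> [f g a b fc gc|f B fc hB] /=; last first.
  apply: CRInt_bound; first exact: intd_param_cont_aux.
  move=> t ht; apply: IHb; first exact: cont_cube_slice.
  by move=> y hy; apply: hB; exact: ext_cube.
rewrite -!CRInt_scal; [|exact: intd_param_cont_aux..].
rewrite -CRInt_plus; [|by apply: cont01_mult_const; exact: intd_param_cont_aux..].
by apply: CRInt_ext => t ht; apply: IHl; exact: cont_cube_slice.
Qed.

Lemma intd_param_cont (d : nat) (f : pt d.+1 -> C) :
  cont_cube f -> cont01 (fun t => intd (fun y => f (ext y t))).
Proof. by have [hl hb] := intd_linear_bounded d; exact: intd_param_cont_aux. Qed.

Section Integral.
Variable d : nat.
Implicit Types f g : pt d -> C.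

Lemma intd_scal f (c : C) : cont_cube f -> intd (fun x => Cmult c (f x)) = Cmult c (intd f).
Proof.
move=> fc; have [hl _] := intd_linear_bounded d.
have := hl f f c (RtoC 0) fc fc.
rewrite Cmult_0_l Cplus_0_r => <-; congr intd.
by apply: functional_extensionality => x; ring.
Qed.

Lemma intd_plus f g : cont_cube f -> cont_cube g ->
  intd (fun x => Cplus (f x) (g x)) = Cplus (intd f) (intd g).
Proof.
move=> fc gc; have [hl _] := intd_linear_bounded d.
have := hl f g (RtoC 1) (RtoC 1) fc gc.
rewrite !Cmult_1_l => <-; congr intd.
by apply: functional_extensionality => x; ring.
Qed.

Lemma intd_sum (I : finType) (P : pred I) (F : I -> pt d -> C) :
  (forall i, cont_cube (F i)) ->
  intd (fun x => Csum P (fun i => F i x)) = Csum P (fun i => intd (F i)).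
Proof.
move=> Fc; rewrite /Csum.
elim: (index_enum I) => [|i r IH].
  have -> : (fun x => \big[Cplus/RtoC 0]_(i <- [::] | P i) F i x) =
            (fun x => Cmult (RtoC 0) (RtoC 0)).
    by apply: functional_extensionality => x; rewrite big_nil; ring.
  by rewrite big_nil intd_scal; [ring | exact: cont_cube_const].
rewrite big_cons -IH; case Pi : (P i); last first.
  by congr intd; apply: functional_extensionality => x; rewrite big_cons Pi.
rewrite -intd_plus //; last exact: cont_cube_big.
by congr intd; apply: functional_extensionality => x; rewrite big_cons Pi.
Qed.

End Integral.

Lemma ext_ord1 (t : R) : ext (fun _ : 'I_0 => 0) t = (fun _ => t).
Proof.
apply: functional_extensionality => j.
by case: (unliftP ord_max j) => [[] //|->]; rewrite ext_max.
Qed.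

(** Transfers the closure properties of continuity on the cube to functions of one variable. *)
Lemma cont01_cube (h : R -> C) : cont01 h <-> cont_cube (fun x : pt 1 => h (x ord0)).
Proof.
split=> hc x hx eps e0.
  have [e [p he]] := hc (x ord0) (hx ord0) eps e0.
  by exists e; split=> // y hy hxy; apply: he.
have [e [p he]] := hc (fun _ => x) (fun _ => hx) eps e0.
by exists e; split=> // y hy hxy; apply: (he (fun _ => y)).
Qed.

Lemma CRInt_intd (h : R -> C) : CRInt h = intd (fun x : pt 1 => h (x ord0)).
Proof. by rewrite /=; apply: CRInt_ext => t _; rewrite ext_ord1. Qed.

Lemma cont01_mult (h k : R -> C) : cont01 h -> cont01 k ->
  cont01 (fun t => Cmult (h t) (k t)).
Proof. by move=> /cont01_cube hc /cont01_cube kc; apply/cont01_cube; exact: cont_cube_mult. Qed.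

Lemma cont01_plus (h k : R -> C) : cont01 h -> cont01 k ->
  cont01 (fun t => Cplus (h t) (k t)).
Proof. by move=> /cont01_cube hc /cont01_cube kc; apply/cont01_cube; exact: cont_cube_plus. Qed.

Lemma cont01_conj (h : R -> C) : cont01 h -> cont01 (fun t => Cconj (h t)).
Proof. by move=> /cont01_cube hc; apply/cont01_cube; exact: cont_cube_conj. Qed.

Lemma cont01_const (c : C) : cont01 (fun _ => c).
Proof. by apply/cont01_cube; exact: cont_cube_const. Qed.

Lemma CRInt_sum (I : finType) (P : pred I) (F : I -> R -> C) :
  (forall i, cont01 (F i)) ->
  CRInt (fun t => Csum P (fun i => F i t)) = Csum P (fun i => CRInt (F i)).
Proof.
move=> Fc; rewrite CRInt_intd (intd_sum P (F := fun i (x : pt 1) => F i (x ord0))).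
  by apply: eq_bigr => i _; rewrite CRInt_intd.
by move=> i; apply/cont01_cube.
Qed.

Lemma cont01_sum (I : finType) (P : pred I) (F : I -> R -> C) :
  (forall i, cont01 (F i)) -> cont01 (fun t => Csum P (fun i => F i t)).
Proof.
move=> Fc; apply/cont01_cube; apply: (cont_cube_big _ _ (F := fun i (x : pt 1) => F i (x ord0))).
by move=> i; apply/cont01_cube.
Qed.

(** * One-dimensional Fourier coefficients and the Fejer kernel *)

Definition echar (m : Z) (s : R) : C := expi (2 * PI * (IZR m * s)).

Lemma echar_omega (m : Z) (x : pt 1) : echar m (x ord0) = omega (fun _ => m) x.
Proof. by rewrite omega_expi /kdot big_ord1. Qed.

Lemma cont01_echar (m : Z) : cont01 (echar m).
Proof.
apply/cont01_cube; have -> : (fun x : pt 1 => echar m (x ord0)) = omega (fun _ => m).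
  by apply: functional_extensionality => x; rewrite echar_omega.
exact: cont_cube_omega.
Qed.

Lemma echarD (m : Z) (s t : R) : echar m (s + t) = Cmult (echar m s) (echar m t).
Proof. by rewrite /echar -expiD; congr expi; ring. Qed.

Lemma echarN (m : Z) (s : R) : echar m (- s) = Cconj (echar m s).
Proof. by rewrite /echar -expiN; congr expi; ring. Qed.

Lemma echar_add (m n : Z) (s : R) : echar (m + n) s = Cmult (echar m s) (echar n s).
Proof. by rewrite /echar -expiD plus_IZR; congr expi; ring. Qed.

Lemma echar_opp (m : Z) (s : R) : echar (- m) s = Cconj (echar m s).
Proof. by rewrite /echar -expiN opp_IZR; congr expi; ring. Qed.

Lemma echar0 (s : R) : echar 0 s = RtoC 1.
Proof. by rewrite /echar Rmult_0_l Rmult_0_r expi0. Qed.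

Lemma expi_2PI_nat (n : nat) : expi (2 * PI * INR n) = RtoC 1.
Proof.
have -> : 2 * PI * INR n = 0 + 2 * INR n * PI by ring.
by rewrite /expi cos_period sin_period cos_0 sin_0.
Qed.

Lemma expi_2PI_Z (m : Z) : expi (2 * PI * IZR m) = RtoC 1.
Proof.
case: (Z_le_gt_dec 0 m) => hm.
  by rewrite -(Z2Nat.id m) // -INR_IZR_INZ expi_2PI_nat.
have -> : 2 * PI * IZR m = - (2 * PI * IZR (- m)) by rewrite opp_IZR; ring.
rewrite expiN -(Z2Nat.id (- m)); last lia.
rewrite -INR_IZR_INZ expi_2PI_nat /Cconj /=; congr pair; ring.
Qed.

Lemma CRInt_echar (m : Z) : CRInt (echar m) = if Z.eqb m 0 then RtoC 1 else RtoC 0.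
Proof.
case: (Z.eqb_spec m 0) => [->|hm]; apply: is_RInt_unique.
  have -> : RtoC 1 = @scal R_AbsRing C_R_CompleteNormedModule (1 - 0) (RtoC 1).
    by rewrite /scal /= /prod_scal /scal /= /mult /RtoC /=; congr pair; ring.
  apply: (@is_RInt_ext C_R_CompleteNormedModule (fun _ => RtoC 1)).
    by move=> x _; rewrite echar0.
  exact: is_RInt_const.
have m0 : IZR m <> 0 by move/eq_IZR.
have P0 := PI_RGT_0.
have q0 : 2 * PI * IZR m <> 0 by move=> h; apply: m0; nra.
have [e1 e2] : cos (2 * PI * (IZR m * 1)) = 1 /\ sin (2 * PI * (IZR m * 1)) = 0.
  by move: (expi_2PI_Z m); rewrite Rmult_1_r => -[-> ->].
have c (x : R) : continuous (fun t => cos (2 * PI * (IZR m * t))) x.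
  by apply: ex_derive_continuous; auto_derive.
have s (x : R) : continuous (fun t => sin (2 * PI * (IZR m * t))) x.
  by apply: ex_derive_continuous; auto_derive.
apply: is_RInt_fct_extend_pair => /=.
- have := @is_RInt_derive R_CompleteNormedModule
    (fun t => sin (2 * PI * (IZR m * t)) / (2 * PI * IZR m))
    (fun t => cos (2 * PI * (IZR m * t))) 0 1.
  rewrite e2 !Rmult_0_r sin_0 /Rdiv Rmult_0_l /minus /plus /opp /= Ropp_0 Rplus_0_r.
  apply=> x _; last exact: c.
  by auto_derive => //; field; lra.
- have := @is_RInt_derive R_CompleteNormedModule
    (fun t => - cos (2 * PI * (IZR m * t)) / (2 * PI * IZR m))
    (fun t => sin (2 * PI * (IZR m * t))) 0 1.
  rewrite e1 !Rmult_0_r cos_0 /minus /plus /opp /= Rplus_opp_r.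
  apply=> x _; last exact: s.
  by auto_derive => //; field; lra.
Qed.

Definition fourier1 (h : R -> C) (m : Z) : C :=
  CRInt (fun s => Cmult (h s) (Cconj (echar m s))).

(** One-sided frequencies 0, ..., n - 1: in the squared modulus the frequency m occurs as a
    difference i - j in n - |m| ways, so the triangular Fejer weights never have to be written. *)
Definition dirichlet (n : nat) (u : R) : C := Csum predT (fun j : 'I_n => echar (Z.of_nat j) u).

Lemma dirichlet_geometric (n : nat) (u : R) :
  Cmult (dirichlet n u) (Cminus (echar 1 u) (RtoC 1)) = Cminus (echar (Z.of_nat n) u) (RtoC 1).
Proof.
rewrite /dirichlet /Csum; elim: n => [|n IH].
  by rewrite big_ord0 echar0; ring.
rewrite big_ord_recr /= Cmult_plus_distr_r IH.
have -> : Z.pos (Pos.of_succ_nat n) = (Z.of_nat n + 1)%Z by lia.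
by rewrite echar_add; ring.
Qed.

Lemma dirichlet_bound (n : nat) (u : R) : Cmod (dirichlet n u) ^ 2 * sin (PI * u) ^ 2 <= 1.
Proof.
have e := f_equal (fun z => Cmod z ^ 2) (dirichlet_geometric n u).
move: e; rewrite /= Rmult_1_r Cmod_mult.
have := Cmod_expi_minus1 (2 * PI * (IZR 1 * u)); rewrite -/(echar 1 u).
have -> : 2 * PI * (1 * u) / 2 = PI * u by field.
move=> h1.
have := Cmod_expi_minus1 (2 * PI * (IZR (Z.of_nat n) * u)); rewrite -/(echar (Z.of_nat n) u).
set w := 2 * PI * _ / 2 => h2 e.
have := SIN_bound w; move=> hw; nra.
Qed.

Section Fejer.
Variables (n : nat) (t : R).

(** The Fejer kernel at t - s multiplied by n; its mass is n instead of 1. *)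
Definition fejer (s : R) : R := Cmod (dirichlet n (t - s)) ^ 2.

Lemma fejer_expand (s : R) : RtoC (fejer s) =
  Csum predT (fun p : 'I_n * 'I_n =>
    Cmult (echar (Z.of_nat p.1 - Z.of_nat p.2) t)
          (Cconj (echar (Z.of_nat p.1 - Z.of_nat p.2) s))).
Proof.
rewrite /fejer Cmod2_conj /dirichlet /Csum Cconj_big big_distrl /=.
rewrite (eq_bigr _ (fun i _ => big_distrr _ _ _)) /= pair_big /=.
apply: eq_bigr => p _.
by rewrite -[Cconj (echar (Z.of_nat p.2) _)]echar_opp -echar_add -echarN -echarD.
Qed.

Lemma fejer_int (h : R -> C) : cont01 h ->
  CRInt (fun s => Cmult (h s) (RtoC (fejer s))) =
  Csum predT (fun p : 'I_n * 'I_n =>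
    Cmult (echar (Z.of_nat p.1 - Z.of_nat p.2) t) (fourier1 h (Z.of_nat p.1 - Z.of_nat p.2))).
Proof.
move=> hc.
have pc (m : Z) : cont01 (fun s => Cmult (h s) (Cconj (echar m s))).
  by apply: cont01_mult => //; apply: cont01_conj; exact: cont01_echar.
transitivity (CRInt (fun s => Csum predT (fun p : 'I_n * 'I_n =>
    Cmult (echar (Z.of_nat p.1 - Z.of_nat p.2) t)
      (Cmult (h s) (Cconj (echar (Z.of_nat p.1 - Z.of_nat p.2) s)))))).
  apply: CRInt_ext => s _; rewrite fejer_expand /Csum big_distrr /=.
  by apply: eq_bigr => p _; ring.
rewrite (CRInt_sum predT (F := fun (p : 'I_n * 'I_n) s =>
  Cmult (echar (Z.of_nat p.1 - Z.of_nat p.2) t)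
      (Cmult (h s) (Cconj (echar (Z.of_nat p.1 - Z.of_nat p.2) s))))).
  by apply: eq_bigr => p _; rewrite CRInt_scal.
by move=> p; apply: cont01_mult; [exact: cont01_const | exact: pc].
Qed.

Lemma cont01_fejer : cont01 (fun s => RtoC (fejer s)).
Proof.
have -> : (fun s => RtoC (fejer s)) = (fun s => Csum predT (fun p : 'I_n * 'I_n =>
    Cmult (echar (Z.of_nat p.1 - Z.of_nat p.2) t)
          (Cconj (echar (Z.of_nat p.1 - Z.of_nat p.2) s)))).
  by apply: functional_extensionality => s; exact: fejer_expand.
apply: cont01_sum => p; apply: cont01_mult; first exact: cont01_const.
by apply: cont01_conj; exact: cont01_echar.
Qed.

(** Only the n diagonal pairs have frequency zero; all others integrate to zero. *)
Lemma fejer_mass : CRInt (fun s => RtoC (fejer s)) = RtoC (INR n).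
Proof.
transitivity (CRInt (fun s => Cmult (RtoC 1) (RtoC (fejer s)))).
  by apply: CRInt_ext => s _; rewrite Cmult_1_l.
rewrite fejer_int; last exact: cont01_const.
have f1 (m : Z) : fourier1 (fun _ => RtoC 1) m = if Z.eqb m 0 then RtoC 1 else RtoC 0.
  rewrite /fourier1; have -> : (m =? 0)%Z = (- m =? 0)%Z by case: m.
  by rewrite -CRInt_echar; apply: CRInt_ext => s _; rewrite Cmult_1_l echar_opp.
rewrite /Csum.
transitivity (\big[Cplus/RtoC 0]_(j < n) RtoC 1); last by rewrite big_const card_ord iter_Cplus1.
rewrite -(pair_big predT predT (fun i j : 'I_n => Cmult (echar (Z.of_nat i - Z.of_nat j) t)
   (fourier1 (fun _ => RtoC 1) (Z.of_nat i - Z.of_nat j)))) /=.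
apply: eq_bigr => i _; rewrite (bigD1 i) //= Z.sub_diag f1 /= echar0 big1 ?Cplus_0_r ?Cmult_1_l //.
move=> j hj; rewrite f1; case: Z.eqb_spec => [e|_]; last by rewrite Cmult_0_r.
by case/eqP: hj; apply: val_inj => /=; lia.
Qed.

(** For each fixed i the differences i - j are distinct and, as n <= M, lie in the box; each of the
    n rows is therefore at most the full box sum. *)
Lemma fejer_coef_bound (h : R -> C) (M : nat) : (n <= M)%N ->
  Cmod (Csum predT (fun p : 'I_n * 'I_n =>
    Cmult (echar (Z.of_nat p.1 - Z.of_nat p.2) t) (fourier1 h (Z.of_nat p.1 - Z.of_nat p.2))))
  <= INR n * \big[Rplus/0]_(a < (2 * M).+1) Cmod (fourier1 h (Z.of_nat a - Z.of_nat M)).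
Proof.
move=> nM; apply: Rle_trans (Cmod_big_le _ _ _) _.
rewrite -(pair_big predT predT (fun i j : 'I_n =>
  Cmod (Cmult (echar (Z.of_nat i - Z.of_nat j) t)
   (fourier1 h (Z.of_nat i - Z.of_nat j))))) /=.
have -> : INR n = INR #|'I_n| by rewrite card_ord.
rewrite -big_Rplus_const.
apply: big_Rplus_le => i _.
have lt (j : 'I_n) : (i + M - j < (2 * M).+1)%N.
  by have := ltn_ord i; lia.
pose sh (j : 'I_n) : 'I_(2 * M).+1 := Ordinal (lt j).
have shinj : injective sh.
  move=> j1 j2 /(f_equal val) /= e; apply: val_inj => /=.
  by have := ltn_ord j1; have := ltn_ord j2; lia.
apply: Rle_trans (big_Rplus_inj_le (F := fun a : 'I_(2 * M).+1 =>
   Cmod (fourier1 h (Z.of_nat a - Z.of_nat M))) shinj _); last by move=> *; exact: Cmod_ge_0.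
apply: big_Rplus_le => j _; rewrite Cmod_mult Cmod_expi Rmult_1_l.
have -> : (Z.of_nat (sh j) - Z.of_nat M)%Z = (Z.of_nat i - Z.of_nat j)%Z.
  by rewrite /=; have := ltn_ord j; lia.
exact: Rle_refl.
Qed.

End Fejer.

Lemma cont01_bounded (h : R -> C) : cont01 h ->
  exists H, 0 <= H /\ forall t, 0 <= t <= 1 -> Cmod (h t) <= H.
Proof.
move=> hc.
have ex_d : forall t, exists e : posreal, 0 <= t <= 1 -> forall s, 0 <= s <= 1 ->
    Rabs (s - t) < e -> Cmod (Cminus (h s) (h t)) < 1.
  move=> t; case: (classic (0 <= t <= 1)) => [ht|ht]; last by exists (mkposreal 1 Rlt_0_1).
  by have [e [p he]] := hc t ht 1 Rlt_0_1; exists (mkposreal e p).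
have [e he] := ClassicalEpsilon.choice _ ex_d.
apply: NNPP => hn.
(* The finite subcover comes under a double negation, whence the argument by contradiction. *)
apply: (@compactness_list 1 (0, tt) (1, tt) (fun x => e x.1)) => -[l hl].
apply: hn; exists (foldr (fun x B => Rmax (Cmod (h x.1) + 1) B) 0 l); split.
  elim: l {hl} => [|x l IH] /=; first lra.
  by apply: Rle_trans IH _; exact: Rmax_r.
move=> s hs.
have [[x []] [hx [[h1 _] [h2 _]]]] := hl (s, tt) (conj hs I).
have h3 : Cmod (h s) <= Cmod (h x) + 1.
  have -> : h s = Cplus (h x) (Cminus (h s) (h x)) by ring.
  apply: Rle_trans (Cmod_triangle _ _) _.
  have := he x h1 s hs h2; lra.
elim: l hx {hl} => [|y l IH] //= [->|hx].
  by apply: Rle_trans h3 _; exact: Rmax_l.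
by apply: Rle_trans (IH hx) _; exact: Rmax_r.
Qed.

(** Evenness and the reflection u -> 1 - u reduce to [rho, 1/2], where sin(PI u) increases; the
    hypothesis keeps |u| away from the zeros 0 and 1. *)
Lemma sin_sq_lower (rho u : R) : 0 < rho -> rho <= Rabs u <= 1 - rho ->
  sin (PI * rho) ^ 2 <= sin (PI * u) ^ 2.
Proof.
move=> r0 hu; have P0 := PI_RGT_0.
wlog u0 : u hu / 0 <= u.
  move=> hw; case: (Rle_dec 0 u) => [|u0]; first exact: hw.
  have -> : PI * u = - (PI * - u) by ring.
  rewrite sin_neg; have -> : (- sin (PI * - u)) ^ 2 = sin (PI * - u) ^ 2 by ring.
  by apply: hw; rewrite ?Rabs_Ropp //; lra.
rewrite Rabs_pos_eq // in hu.
have s0 : 0 <= sin (PI * rho) by apply: sin_ge_0; nra.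
suff : sin (PI * rho) <= sin (PI * u) by nra.
case: (Rle_dec u (1 / 2)) => h.
  by apply: sin_incr_1; nra.
have -> : sin (PI * u) = sin (PI * (1 - u)).
  by rewrite Rmult_minus_distr_l Rmult_1_r -sin_PI_x.
by apply: sin_incr_1; nra.
Qed.

(** Fejer's argument: n h(t) is the integral of h F plus that of (h(t) - h) F, where F has mass n.
    The first is at most n times the coefficient sum; the second is small near t by continuity, and
    elsewhere F is bounded independently of n. As h is not assumed periodic, the peaks of F at t - 1
    and t + 1 must keep away from [0,1], which 0 < t < 1 ensures. *)
Lemma fourier1_bound_interior (h : R -> C) (t eps : R) :
  cont01 h -> 0 < t < 1 -> 0 < eps -> exists M0 : nat, forall M, (M0 <= M)%N ->
  Cmod (h t) <= eps + \big[Rplus/0]_(a < (2 * M).+1) Cmod (fourier1 h (Z.of_nat a - Z.of_nat M)).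
Proof.
move=> hc ht e0.
have [H [H0 hH]] := cont01_bounded hc.
have t01 : 0 <= t <= 1 by lra.
have [d1 [d1p hd]] := hc t t01 (eps / 2) ltac:(lra).
(* The bounds by t and 1 - t give |t - s| <= 1 - rho for every s in [0,1]; the bound by [d1] puts
   the near part inside the continuity radius. *)
set rho := Rmin d1 (Rmin t (1 - t)).
have r0 : 0 < rho by rewrite /rho; do 2?apply: Rmin_pos; lra.
have r1 : rho <= d1 by exact: Rmin_l.
have r2 : rho <= t by apply: Rle_trans (Rmin_r _ _) _; exact: Rmin_l.
have r3 : rho <= 1 - t by apply: Rle_trans (Rmin_r _ _) _; exact: Rmin_r.
set c := sin (PI * rho) ^ 2.
have c0 : 0 < c.
  by apply: pow_lt; apply: sin_gt_0; have := PI_RGT_0; nra.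
(* Far from t the integrand is at most 2 H / c for every n; n is chosen so that this is at most n
   eps / 2. *)
have [n [n0 hn]] : exists n : nat, 0 < INR n /\ 2 * H / c <= INR n * (eps / 2).
  have [n hn] := nfloor_ex (2 * H / c / (eps / 2))
     ltac:(apply: Rdiv_le_0_compat; [apply: Rdiv_le_0_compat; lra | lra]).
  exists n.+1; split; first by apply: lt_0_INR; lia.
  rewrite S_INR; have {1}-> : 2 * H / c = 2 * H / c / (eps / 2) * (eps / 2) by field; lra.
  by apply: Rmult_le_compat_r; lra.
exists n => M nM.
set S := \big[Rplus/0]_(a < _) _.
have fc := cont01_fejer n t.
have dc : cont01 (fun s => Cmult (Cplus (h t) (Cmult (RtoC (-1)) (h s))) (RtoC (fejer n t s))).
  apply: cont01_mult => //; apply: cont01_plus; first exact: cont01_const.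
  by apply: cont01_mult_const.
have eI : Cmult (RtoC (INR n)) (h t) =
  Cplus (CRInt (fun s => Cmult (Cplus (h t) (Cmult (RtoC (-1)) (h s))) (RtoC (fejer n t s))))
        (CRInt (fun s => Cmult (h s) (RtoC (fejer n t s)))).
  rewrite -CRInt_plus //; last exact: cont01_mult.
  rewrite -(fejer_mass n t) Cmult_comm -CRInt_scal //.
  apply: CRInt_ext => s _.
  have -> : RtoC (-1) = Copp (RtoC 1) by rewrite /RtoC /Copp /=; congr pair; ring.
  ring.
have b2 : Cmod (CRInt (fun s => Cmult (h s) (RtoC (fejer n t s)))) <= INR n * S.
  by rewrite fejer_int //; exact: fejer_coef_bound.
have b1 : Cmod (CRInt (fun s => Cmult (Cplus (h t) (Cmult (RtoC (-1)) (h s))) (RtoC (fejer n t s))))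
    <= eps / 2 * INR n + (1 - 0) * (2 * H / c).
  rewrite -norm_Cmod.
  (* A single majorant for both regions: the first summand controls s near t, the second s far from
     t. *)
  apply: (@norm_RInt_le C_R_CompleteNormedModule
     (fun s => Cmult (Cplus (h t) (Cmult (RtoC (-1)) (h s))) (RtoC (fejer n t s)))
     (fun s => eps / 2 * fejer n t s + 2 * H / c) 0 1); first lra.
  - move=> s hs; rewrite norm_Cmod; rewrite Cmod_mult Cmod_R.
    have F0 : 0 <= fejer n t s by exact: pow2_ge_0.
    rewrite Rabs_pos_eq //.
    have -> : Cplus (h t) (Cmult (RtoC (-1)) (h s)) = Copp (Cminus (h s) (h t)).
      have -> : RtoC (-1) = Copp (RtoC 1) by rewrite /RtoC /Copp /=; congr pair; ring.
      ring.
    rewrite Cmod_opp.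
    have q0 : 0 <= 2 * H / c by apply: Rdiv_le_0_compat; lra.
    case: (Rlt_dec (Rabs (s - t)) rho) => hr.
      have := hd s hs ltac:(lra); nra.
    have hs2 : rho <= Rabs (t - s) <= 1 - rho.
      split; first by rewrite Rabs_minus_sym; lra.
      by apply: Rabs_le; lra.
    have := sin_sq_lower r0 hs2; rewrite -/c => hcs.
    have := dirichlet_bound n (t - s); rewrite -/(fejer n t s) => hF.
    have Fc : fejer n t s * c <= 1 by nra.
    have D2 : Cmod (Cminus (h s) (h t)) <= 2 * H.
      apply: Rle_trans (Cmod_triangle _ _) _; rewrite Cmod_opp.
      have := hH s hs; have := hH t t01; lra.
    apply: (Rle_trans _ (2 * H * fejer n t s)); first nra.
    apply: (Rle_trans _ (2 * H / c)); last nra.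
    have q1 : 0 <= H * (1 - fejer n t s * c) by apply: Rmult_le_pos; lra.
    by apply: (Rmult_le_reg_r c) => //; rewrite /Rdiv Rmult_assoc (Rmult_assoc _ (/ c)) Rinv_l; lra.
  - exact: is_CRInt_cont01.
  - apply: is_RInt_plus; last exact: is_RInt_const.
    apply: is_RInt_scal.
    have := is_CRInt_cont01 fc; rewrite fejer_mass.
    by move/is_RInt_fct_extend_fst.
have := f_equal Cmod eI; rewrite Cmod_mult Cmod_R Rabs_pos_eq; last lra.
move=> e.
have : INR n * Cmod (h t) <= INR n * (eps + S).
  rewrite e; apply: Rle_trans (Cmod_triangle _ _) _; lra.
by move/Rmult_le_reg_l; apply.
Qed.

Lemma fourier1_bound (h : R -> C) (t eps : R) :
  cont01 h -> 0 <= t <= 1 -> 0 < eps -> exists M0 : nat, forall M, (M0 <= M)%N ->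
  Cmod (h t) <= eps + \big[Rplus/0]_(a < (2 * M).+1) Cmod (fourier1 h (Z.of_nat a - Z.of_nat M)).
Proof.
move=> hc ht e0.
have [e [p he]] := hc t ht (eps / 2) ltac:(lra).
have [s [hs hst]] : exists s, 0 < s < 1 /\ Rabs (s - t) < e.
  (* A step of at most 1/4 towards the middle lands strictly inside the interval, from either
     half. *)
  set m := Rmin (e / 2) (1 / 4).
  have m0 : 0 < m by apply: Rmin_pos; lra.
  have m1 : m <= e / 2 by exact: Rmin_l.
  have m2 : m <= 1 / 4 by exact: Rmin_r.
  case: (Rle_dec t (1 / 2)) => ht2.
    by exists (t + m); split; [lra | apply: Rabs_def1; lra].
  by exists (t - m); split; [lra | apply: Rabs_def1; lra].
have [M0 hM] := fourier1_bound_interior hc hs (ltac:(lra) : 0 < eps / 2).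
exists M0 => M /hM h1.
have := he s ltac:(lra) hst.
have -> : h t = Cplus (h s) (Copp (Cminus (h s) (h t))) by ring.
move=> h2; apply: Rle_trans (Cmod_triangle _ _) _; rewrite Cmod_opp.
move: h2; have -> : Cplus (h s) (Copp (Cminus (h s) (h t))) = h t by ring.
lra.
Qed.

(** * Fourier coefficients on the cube and the sup bound *)

Section Fourier.
Variable d : nat.
Implicit Types f g : pt d -> C.

Lemma cont_cube_fhat f (k : freq d) :
  cont_cube f -> cont_cube (fun x => Cmult (f x) (Cconj (omega k x))).
Proof.
move=> fc; apply: cont_cube_mult => //; apply: cont_cube_conj; exact: cont_cube_omega.
Qed.

Lemma fhat_scal f (c : C) (k : freq d) :
  cont_cube f -> fhat (fun x => Cmult c (f x)) k = Cmult c (fhat f k).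
Proof.
move=> fc; rewrite /fhat -intd_scal; last exact: cont_cube_fhat.
by congr intd; apply: functional_extensionality => x; ring.
Qed.

Lemma fhat_plus f g (k : freq d) : cont_cube f -> cont_cube g ->
  fhat (fun x => Cplus (f x) (g x)) k = Cplus (fhat f k) (fhat g k).
Proof.
move=> fc gc; rewrite /fhat -intd_plus; [|exact: cont_cube_fhat..].
by congr intd; apply: functional_extensionality => x; ring.
Qed.

Lemma fhat_sum (I : finType) (P : pred I) (F : I -> pt d -> C) (k : freq d) :
  (forall i, cont_cube (F i)) ->
  fhat (fun x => Csum P (fun i => F i x)) k = Csum P (fun i => fhat (F i) k).
Proof.
move=> Fc; rewrite /fhat -intd_sum; last by move=> i; exact: cont_cube_fhat.
by congr intd; apply: functional_extensionality => x; rewrite /Csum big_distrl.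
Qed.

Lemma fhat_mul_conj_omega f (k l : freq d) :
  fhat (fun x => Cmult (f x) (Cconj (omega l x))) k = fhat f (fun j => (k j + l j)%Z).
Proof.
by congr intd; apply: functional_extensionality => x; rewrite omegaD Cmult_conj; ring.
Qed.

End Fourier.

(** The last coordinate is the outermost integration variable, so splitting the character suffices
    and no order of integration is exchanged. *)
Lemma fhat_slice (d : nat) (f : pt d.+1 -> C) (k : freq d.+1) : cont_cube f ->
  fhat f k = fourier1 (fun t => fhat (fun y => f (ext y t)) (fun i : 'I_d => k (lift ord_max i)))
                      (k ord_max).
Proof.
move=> fc; apply: CRInt_ext => t ht.
rewrite Cmult_comm -intd_scal; last by apply: cont_cube_fhat; exact: cont_cube_slice.
by apply: intd_ext => y hy; rewrite omega_ext Cmult_conj -/(echar _ _); ring.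
Qed.

Lemma cont01_fhat_slice (d : nat) (f : pt d.+1 -> C) (k : freq d) : cont_cube f ->
  cont01 (fun t => fhat (fun y => f (ext y t)) k).
Proof.
move=> fc.
(* Padding with last frequency 0 turns the slice coefficient into the inner integral of one
   continuous function on the larger cube. *)
pose k' : freq d.+1 := fun j => match unlift ord_max j with Some i => k i | None => 0%Z end.
have -> : (fun t => fhat (fun y => f (ext y t)) k) =
   (fun t => intd (fun y => Cmult (f (ext y t)) (Cconj (omega k' (ext y t))))).
  apply: functional_extensionality => t; congr intd.
  apply: functional_extensionality => y; rewrite omega_ext /k' unlift_none -/(echar 0 t) echar0.
  rewrite Cmult_1_r; congr (Cmult _ (Cconj (omega _ _))).
  by apply: functional_extensionality => i; rewrite liftK.
apply: (intd_param_cont (f := fun x => Cmult (f x) (Cconj (omega k' x)))).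
exact: cont_cube_fhat.
Qed.

Lemma boxk_inj (d M : nat) : injective (@boxk d M).
Proof.
move=> u v e; apply/ffunP => j; apply: val_inj => /=.
by have := f_equal (fun k : freq d => k j) e; rewrite /boxk; lia.
Qed.

Section BoxExtension.
Variables (d M M' : nat).
Hypothesis le_MM' : (M <= M')%N.

(** An index a in a box of radius M stands for the frequency a - M; moving to radius M' without
    changing the frequency therefore adds M' - M. *)
Definition box_ext (p : {ffun 'I_d -> 'I_(2 * M).+1} * 'I_(2 * M').+1) :
    {ffun 'I_d.+1 -> 'I_(2 * M').+1} :=
  [ffun j => match unlift ord_max j with
             | Some i => inord (p.1 i + (M' - M)) | None => p.2 end].

Lemma box_ext_lift p (i : 'I_d) : boxk (box_ext p) (lift ord_max i) = boxk p.1 i.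
Proof.
rewrite /boxk ffunE liftK inordK; first lia.
by have := ltn_ord (p.1 i); lia.
Qed.

Lemma box_ext_max p : boxk (box_ext p) ord_max = (Z.of_nat p.2 - Z.of_nat M')%Z.
Proof. by rewrite /boxk ffunE unlift_none. Qed.

Lemma box_ext_inj : injective box_ext.
Proof.
move=> [u a] [v b] e; congr pair.
  apply: boxk_inj; apply: functional_extensionality => i.
  by rewrite -(box_ext_lift (u, a)) e box_ext_lift.
apply: val_inj => /=; have := box_ext_max (u, a); rewrite e box_ext_max /=; lia.
Qed.

End BoxExtension.

(* Applied to f minus a partial sum of its Fourier series, this replaces Fourier
   inversion: it bounds the truncation error pointwise, also on the boundary of the
   cube, where f is not assumed periodic. *)
Lemma sup_le_fourier_l1 (d : nat) (f : pt d -> C) (B : R) : cont_cube f ->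
  (forall M, Rsum (fun u : {ffun 'I_d -> 'I_(2 * M).+1} => Cmod (fhat f (boxk u))) <= B) ->
  forall x, in_cube x -> Cmod (f x) <= B.
Proof.
elim: d f => [|d IH] f fc hB x hx.
  have := hB 0%N; rewrite /Rsum.
  have -> : f x = f (fun _ => 0) by congr f; apply: functional_extensionality => -[].
  have one (u : {ffun 'I_0 -> 'I_(2 * 0).+1}) : Cmod (fhat f (boxk u)) = Cmod (f (fun _ => 0)).
    rewrite /fhat /= omega_expi /kdot big_ord0 Rmult_0_r expi0.
    by rewrite Cmod_mult Cmod_conj Cmod_1 Rmult_1_r.
  rewrite (eq_bigr _ (fun u _ => one u)) big_Rplus_const card_ffun !card_ord expn0 -[INR 1]/1; lra.
rewrite -(ext_eta x); set y := (fun i => _); set t := x ord_max.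
have ht : 0 <= t <= 1 by exact: hx.
apply: (IH (fun y => f (ext y t))); [exact: cont_cube_slice | move=> M | by move=> i; exact: hx].
pose h (u : {ffun 'I_d -> 'I_(2 * M).+1}) s := fhat (fun y => f (ext y s)) (boxk u).
apply: le_epsilon => eps e0.
set n := INR #|{: {ffun 'I_d -> 'I_(2 * M).+1}}|.
have n0 : 0 <= n by exact: pos_INR.
(* The error [eps] is shared among the n slice frequencies, each of which gets its own
   one-dimensional bound. *)
have e1 : 0 < eps / (n + 1) by apply: Rdiv_lt_0_compat; lra.
have ex_M0 u := fourier1_bound (h := h u) (cont01_fhat_slice (boxk u) fc) ht e1.
have [M0 hM0] := ClassicalEpsilon.choice _ ex_M0.
(* One radius for all slice frequencies: beyond each of their thresholds, and at least [M] so that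
   the boxes embed. *)
pose M' := maxn M (\max_u M0 u).
have le_MM' : (M <= M')%N by exact: leq_maxl.
apply: Rle_trans (_ : _ <= \big[Rplus/0]_u (eps / (n + 1) +
   \big[Rplus/0]_(a < (2 * M').+1) Cmod (fourier1 (h u) (Z.of_nat a - Z.of_nat M')))) _.
  apply: big_Rplus_le => u _; apply: hM0.
  by apply: leq_trans (leq_maxr _ _); exact: (leq_bigmax u).
rewrite big_split /= big_Rplus_const -/n Rplus_comm; apply: Rplus_le_compat.
  apply: Rle_trans (hB M'); rewrite pair_big /=.
  apply: Rle_trans (_ : _ <= \big[Rplus/0]_p (Cmod (fhat f (boxk (box_ext p))))) _; last first.
    exact: (big_Rplus_inj_le (F := fun v => Cmod (fhat f (boxk v)))
       (@box_ext_inj d M M' le_MM') (fun v => Cmod_ge_0 _)).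
  right; apply: eq_bigr => p _; rewrite fhat_slice // box_ext_max.
  congr (Cmod (fourier1 _ _)); apply: functional_extensionality => s; congr fhat.
  by apply: functional_extensionality => i; rewrite box_ext_lift.
have -> : n * (eps / (n + 1)) = eps * (n / (n + 1)) by field; lra.
have : n / (n + 1) <= 1 by apply/Rle_div_l; lra.
nra.
Qed.

Lemma intd_omega (d : nat) (k : freq d) :
  intd (omega k) = if [forall j, Z.eqb (k j) 0] then RtoC 1 else RtoC 0.
Proof.
elim: d k => [|d IH] k.
  rewrite /= omega_expi /kdot big_ord0 Rmult_0_r expi0.
  by case: forallP => // -[] [].
have -> : intd (omega k) =
  Cmult (intd (omega (fun i : 'I_d => k (lift ord_max i)))) (CRInt (echar (k ord_max))).
  rewrite -CRInt_scal; last exact: cont01_echar.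
  apply: CRInt_ext => t ht; rewrite Cmult_comm -intd_scal; last exact: cont_cube_omega.
  by apply: intd_ext => y hy; rewrite omega_ext Cmult_comm.
rewrite IH CRInt_echar; case: forallP => [h1|h1].
  case E : (Z.eqb _ _); case: forallP => h2; rewrite ?Cmult_1_l //.
    by case: h2 => j; case: (unliftP ord_max j) => [i ->|->].
  by have := h2 ord_max; rewrite E.
by case: forallP => [h2|_]; [case: h1 => i; exact: h2 | rewrite Cmult_0_l].
Qed.

Lemma fhat_omega (d : nat) (k l : freq d) :
  fhat (omega l) k = if [forall j, Z.eqb (k j) (l j)] then RtoC 1 else RtoC 0.
Proof.
have -> : fhat (omega l) k = intd (omega (fun j => (l j + - k j)%Z)).
  congr intd; apply: functional_extensionality => x.
  by rewrite (omegaD l (fun j => (- k j)%Z)) omegaN.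
rewrite intd_omega; congr (if _ then _ else _); apply: eq_forallb => j.
by do 2 case: Z.eqb_spec => //; lia.
Qed.

(** * Real powers, one-dimensional weights and their sums *)

Lemma Rmaxj_ge (d : nat) (F : 'I_d -> R) (j : 'I_d) : F j <= Rmaxj F.
Proof.
rewrite /Rmaxj; have : j \in index_enum 'I_d by rewrite mem_index_enum.
elim: (index_enum 'I_d) => [|i r IH] //=; rewrite in_cons big_cons => /orP [/eqP ->|/IH h].
  exact: Rmax_l.
by apply: Rle_trans h _; exact: Rmax_r.
Qed.

Lemma Rmaxj_le (d : nat) (F : 'I_d -> R) (B : R) :
  0 <= B -> (forall j, F j <= B) -> Rmaxj F <= B.
Proof. by move=> B0 h; apply: (big_ind (fun x => x <= B)) => // x y; exact: Rmax_lub. Qed.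

Lemma RlebP (x y : R) : reflect (x <= y) (Rleb x y).
Proof. by rewrite /Rleb; case: Rle_dec => h; constructor. Qed.

Lemma Rpower_gt0 (x y : R) : 0 < Rpower x y.
Proof. exact: exp_pos. Qed.

Lemma Rpower_ge1 (x y : R) : 1 <= x -> 0 <= y -> 1 <= Rpower x y.
Proof.
by move=> x1 y0; rewrite -(Rpower_O x); [apply: Rle_Rpower | lra].
Qed.

Lemma Rpower_le_opp (x y a : R) : 0 <= a -> 0 < x <= y -> Rpower y (- a) <= Rpower x (- a).
Proof.
move=> a0 hxy; rewrite !Rpower_Ropp; apply: Rinv_le_contravar; first exact: Rpower_gt0.
exact: Rle_Rpower_l.
Qed.

Lemma rpowE (x y : R) : 0 < x -> rpow x y = Rpower x y.
Proof. by move=> x0; rewrite /rpow; case: (Req_EM_T x 0) => // e; lra. Qed.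

Section PowerSums.
Variable p : R.
Hypothesis p_gt1 : 1 < p.

Definition tail_cst : R := Rpower 2 p / (p - 1).

Lemma tail_cst_gt0 : 0 < tail_cst.
Proof. by apply: Rdiv_lt_0_compat; [exact: Rpower_gt0 | lra]. Qed.

(** Discrete integral test: by the mean value theorem the difference is (p - 1) c^(-p) with c < x +
    1 <= 2 x. This is where both factors of [tail_cst] come from. *)
Lemma Rpower_telescope (x : R) : 1 <= x ->
  Rpower x (- p) <= tail_cst * (Rpower x (- (p - 1)) - Rpower (x + 1) (- (p - 1))).
Proof.
move=> x1.
have [c [e hc]] := MVT_cor2 (fun z => Rpower z (- (p - 1)))
  (fun z => - (p - 1) * Rpower z (- (p - 1) - 1)) x (x + 1) ltac:(lra)
  (fun c hc => derivable_pt_lim_power c (- (p - 1)) ltac:(lra)).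
have -> : Rpower x (- (p - 1)) - Rpower (x + 1) (- (p - 1)) = (p - 1) * Rpower c (- p).
  have -> : - p = - (p - 1) - 1 by ring.
  by rewrite -[LHS]Ropp_involutive Ropp_minus_distr e; ring.
have h : Rpower (2 * x) (- p) <= Rpower c (- p) by apply: Rpower_le_opp; lra.
rewrite -Rpower_mult_distr in h; [|lra|lra].
rewrite /tail_cst.
have -> : Rpower 2 p / (p - 1) * ((p - 1) * Rpower c (- p)) = Rpower 2 p * Rpower c (- p).
  by field; lra.
apply: Rle_trans (_ : Rpower 2 p * (Rpower 2 (- p) * Rpower x (- p)) <= _).
  by rewrite -Rmult_assoc -Rpower_plus Rplus_opp_r Rpower_O; lra.
by apply: Rmult_le_compat_l => //; left; exact: Rpower_gt0.
Qed.

Lemma power_tail (T : R) (M : nat) : 0 < T ->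
  \big[Rplus/0]_(h < M) (if Rleb (INR h.+1) T then 0 else Rpower (INR h.+1) (- p))
  <= tail_cst * Rpower T (- (p - 1)).
Proof.
move=> T0; have c0 := tail_cst_gt0.
(* The maximum with [T] makes the induction uniform: up to [T] the terms vanish and the bound can
   only grow, beyond [T] the maximum is M + 1 and the bound telescopes. *)
suff h : \big[Rplus/0]_(h < M) (if Rleb (INR h.+1) T then 0 else Rpower (INR h.+1) (- p))
  <= tail_cst * (Rpower T (- (p - 1)) - Rpower (Rmax T (INR M.+1)) (- (p - 1))).
  have := Rpower_gt0 (Rmax T (INR M.+1)) (- (p - 1)); nra.
elim: M => [|M IH].
  rewrite big_ord0; apply: Rmult_le_pos; first lra.
  have := @Rpower_le_opp T (Rmax T (INR 1)) (p - 1) ltac:(lra) (conj T0 (Rmax_l _ _)); lra.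
rewrite big_ord_recr /=.
case: RlebP => hT; last first.
  have m1 : 1 <= INR M.+1 by rewrite S_INR; have := pos_INR M; lra.
  have := Rpower_telescope m1; rewrite -S_INR => h.
  rewrite Rmax_right in IH; last lra.
  rewrite Rmax_right; last by rewrite S_INR; lra.
  by apply: Rle_trans (Rplus_le_compat _ _ _ _ IH h) _; lra.
rewrite Rplus_0_r; apply: Rle_trans IH _; apply: Rmult_le_compat_l; first lra.
have : Rpower (Rmax T (INR M.+2)) (- (p - 1)) <= Rpower (Rmax T (INR M.+1)) (- (p - 1)).
  apply: Rpower_le_opp; first lra.
  split; first by apply: Rlt_le_trans T0 _; exact: Rmax_l.
  by apply: Rle_max_compat_l; rewrite (S_INR M.+1); lra.
lra.
Qed.

Lemma sum_symmetric (F : nat -> R) (M : nat) :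
  \big[Rplus/0]_(a < (2 * M).+1) F (Z.abs_nat (Z.of_nat a - Z.of_nat M)) =
  F 0%N + 2 * \big[Rplus/0]_(h < M) F h.+1.
Proof.
elim: M => [|M IH]; first by rewrite big_ord_recl !big_ord0 /=; ring.
have -> : (2 * M.+1 = (2 * M).+2)%N by lia.
rewrite big_ord_recl big_ord_recr [X in _ = _ + 2 * X]big_ord_recr /=.
have -> : \big[Rplus/0]_(i < (2 * M).+1)
    F (Z.abs_nat (Z.of_nat (bump 0 i) - Z.pos (Pos.of_succ_nat M))) =
  \big[Rplus/0]_(a < (2 * M).+1) F (Z.abs_nat (Z.of_nat a - Z.of_nat M)).
  by apply: eq_bigr => i _; congr F; rewrite /bump leq0n add1n; lia.
rewrite IH.
have -> : Pos.to_nat (Pos.of_succ_nat M) = M.+1 by lia.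
have -> : Z.abs_nat (Z.of_nat (bump 0 (2 * M).+1) - Z.pos (Pos.of_succ_nat M)) = M.+1.
  by rewrite /bump leq0n add1n; lia.
rewrite -[X in _ = _ + 2 * (X + _)]/(\big[Rplus/0]_(h < M) F h.+1); ring.
Qed.

(** The threshold 1/2 lies below every index, so the tail is the whole sum. *)
Lemma sum_pos_powers (M : nat) :
  \big[Rplus/0]_(h < M) Rpower (INR h.+1) (- p) <= tail_cst * Rpower (/ 2) (- (p - 1)).
Proof.
apply: Rle_trans (power_tail M (ltac:(lra) : 0 < / 2)).
apply: big_Rplus_le => h _; case: RlebP => [|_]; last lra.
by rewrite S_INR; have := pos_INR h; lra.
Qed.

(** An upper bound for the partial sums of 1 + 2 zeta(p): the zero frequency, then both signs. *)
Definition full_cst : R := 1 + 2 * (tail_cst * Rpower (/ 2) (- (p - 1))).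

Lemma full_cst_ge1 : 1 <= full_cst.
Proof.
rewrite /full_cst; have := tail_cst_gt0; have := Rpower_gt0 (/ 2) (- (p - 1)); nra.
Qed.

End PowerSums.

Section Weights.
Variables (beta gam : R).
Hypotheses (beta_gt0 : 0 < beta) (gam_gt0 : 0 < gam) (gam_le1 : gam <= 1).

Lemma r1_ge1 (h : Z) : 1 <= r1 beta gam h.
Proof. exact: Rmax_r. Qed.

Lemma r1_abs (h : Z) : r1 beta gam h = r1 beta gam (Z.of_nat (Z.abs_nat h)).
Proof. by rewrite /r1 -!abs_IZR Zabs2Nat.id_abs Z.abs_idemp. Qed.

(** Depends on the convention [rpow 0 y = 0]: [Rpower 0 y] is 1, because [ln 0] is 0, and would give
    the weight 1/gam. *)
Lemma r1_0 : r1 beta gam 0 = 1.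
Proof.
rewrite /r1 Rabs_R0 /rpow; case: (Req_EM_T 0 0) => // ?; rewrite /Rdiv Rmult_0_l.
by rewrite Rmax_right; lra.
Qed.

Lemma r1_pos (n : nat) :
  r1 beta gam (Z.of_nat n.+1) = Rmax (Rpower (INR n.+1) (2 * beta) / gam) 1.
Proof.
have n0 : 0 < INR n.+1 by apply: lt_0_INR; lia.
by rewrite /r1 -INR_IZR_INZ Rabs_pos_eq ?rpowE //; lra.
Qed.

Lemma r1_inv_le (n : nat) : / r1 beta gam (Z.of_nat n.+1) <= Rpower (INR n.+1) (- (2 * beta)).
Proof.
rewrite r1_pos Rpower_Ropp; apply: Rinv_le_contravar; first exact: Rpower_gt0.
apply: Rle_trans (Rmax_l _ _); have := Rpower_gt0 (INR n.+1) (2 * beta) => q0.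
by apply/Rle_div_r; nra.
Qed.

Lemma r1_gt (nu : R) (n : nat) : 1 < nu -> nu < r1 beta gam (Z.of_nat n.+1) ->
  Rpower (nu * gam) (/ (2 * beta)) < INR n.+1.
Proof.
move=> nu1; rewrite r1_pos => h.
have n0 : 0 < INR n.+1 by apply: lt_0_INR; lia.
have {}h : nu < Rpower (INR n.+1) (2 * beta) / gam.
  by move: h; rewrite /Rmax; case: Rle_dec => ? ?; lra.
have h2 : nu * gam < Rpower (INR n.+1) (2 * beta) by apply/Rlt_div_r.
have -> : INR n.+1 = Rpower (Rpower (INR n.+1) (2 * beta)) (/ (2 * beta)).
  by rewrite Rpower_mult Rinv_r ?Rpower_1 //; lra.
apply: Rlt_Rpower_l; first by apply: Rinv_0_lt_compat; lra.
by split=> //; nra.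
Qed.

Lemma r1_le_bound (nu : R) (h : Z) : 1 < nu -> r1 beta gam h <= nu ->
  Rabs (IZR h) <= Rpower (nu * gam) (/ (2 * beta)).
Proof.
move=> nu1; rewrite r1_abs -abs_IZR -Zabs2Nat.id_abs.
case: (Z.abs_nat h) => [|n]; first by move=> _; left; exact: Rpower_gt0.
rewrite r1_pos -INR_IZR_INZ => hr.
have n0 : 0 < INR n.+1 by apply: lt_0_INR; lia.
have h2 : Rpower (INR n.+1) (2 * beta) <= nu * gam.
  by apply/Rle_div_l => //; apply: Rle_trans hr; exact: Rmax_l.
have {1}-> : INR n.+1 = Rpower (Rpower (INR n.+1) (2 * beta)) (/ (2 * beta)).
  by rewrite Rpower_mult Rinv_r ?Rpower_1 //; lra.
apply: Rle_Rpower_l; first by left; apply: Rinv_0_lt_compat; lra.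
by split=> //; exact: Rpower_gt0.
Qed.

Hypothesis beta_gt_half : 1 < 2 * beta.

Lemma r1_sum_full (M : nat) :
  \big[Rplus/0]_(a < (2 * M).+1) (/ r1 beta gam (Z.of_nat a - Z.of_nat M)) <= full_cst (2 * beta).
Proof.
rewrite (eq_bigr (fun a : 'I_(2 * M).+1 => / r1 beta gam
  (Z.of_nat (Z.abs_nat (Z.of_nat a - Z.of_nat M))))); last by move=> a _; rewrite r1_abs.
rewrite (sum_symmetric (fun n => / r1 beta gam (Z.of_nat n))) r1_0 Rinv_1.
apply: Rplus_le_compat_l; apply: Rmult_le_compat_l; first lra.
apply: Rle_trans (sum_pos_powers beta_gt_half M).
by apply: big_Rplus_le => h _; exact: r1_inv_le.
Qed.

(** A weight above nu forces |h| > T = (nu gam)^(1/(2 beta)), so this is a power tail beyond T; its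
    bound T^(1 - 2 beta) splits into the two powers displayed. *)
Lemma r1_sum_tail (nu : R) (M : nat) : 1 < nu ->
  \big[Rplus/0]_(a < (2 * M).+1)
    (if Rleb (r1 beta gam (Z.of_nat a - Z.of_nat M)) nu then 0
     else / r1 beta gam (Z.of_nat a - Z.of_nat M))
  <= 2 * tail_cst (2 * beta) * Rpower gam (/ (2 * beta) - 1) * Rpower nu (/ (2 * beta) - 1).
Proof.
move=> nu1; set T := Rpower (nu * gam) (/ (2 * beta)).
pose F n := if Rleb (r1 beta gam (Z.of_nat n)) nu then 0 else / r1 beta gam (Z.of_nat n).
rewrite (eq_bigr (fun a : 'I_(2 * M).+1 => F (Z.abs_nat (Z.of_nat a - Z.of_nat M)))); last first.
  by move=> a _; rewrite /F -r1_abs.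
rewrite sum_symmetric.
have -> : F 0%N = 0 by rewrite /F r1_0; case: RlebP => //; lra.
rewrite Rplus_0_l Rmult_assoc Rpower_mult_distr; [|lra|lra].
have -> : Rpower (gam * nu) (/ (2 * beta) - 1) = Rpower T (- (2 * beta - 1)).
  by rewrite /T Rpower_mult (Rmult_comm gam nu); congr Rpower; field; lra.
rewrite Rmult_assoc; apply: Rmult_le_compat_l; first lra.
have T0 : 0 < T by exact: Rpower_gt0.
apply: Rle_trans (power_tail beta_gt_half M T0).
apply: big_Rplus_le => h _; rewrite /F; case: RlebP => hr.
  by case: RlebP => _; [lra | left; exact: Rpower_gt0].
case: RlebP => [hT|_]; last exact: r1_inv_le.
by have := @r1_gt nu h nu1 ltac:(lra); rewrite -/T; lra.
Qed.

End Weights.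

(** * The Korobov norm as a supremum of box sums *)

Lemma box_sum_le_normH2 (d : nat) (beta : R) (gam : 'I_d -> R) (f : pt d -> C) (M : nat) :
  is_finite (normH2 beta gam f) ->
  Rsum (fun u : {ffun 'I_d -> 'I_(2 * M).+1} => rw beta gam (boxk u) * Cmod (fhat f (boxk u)) ^ 2)
  <= real (normH2 beta gam f).
Proof.
move=> fin.
have [ub _] := Lub_Rbar_correct (fun s => exists M : nat,
  s = Rsum (fun u : {ffun 'I_d -> 'I_(2 * M).+1} =>
    rw beta gam (boxk u) * Cmod (fhat f (boxk u)) ^ 2)).
have := ub _ (ex_intro _ M erefl).
by rewrite -/(sumZd (fun k => rw beta gam k * Cmod (fhat f k) ^ 2)) -/(normH2 beta gam f) -fin.
Qed.

Lemma rw_ge1 (d : nat) (beta : R) (gam : 'I_d -> R) (k : freq d) : 1 <= rw beta gam k.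
Proof. by apply: big_Rmult_ge1 => j _; exact: r1_ge1. Qed.

Lemma normH2_ge0 (d : nat) (beta : R) (gam : 'I_d -> R) (f : pt d -> C) :
  is_finite (normH2 beta gam f) -> 0 <= real (normH2 beta gam f).
Proof.
move=> fin; apply: Rle_trans (box_sum_le_normH2 0 fin).
apply: big_Rplus_ge0 => u _; apply: Rmult_le_pos; last exact: pow2_ge_0.
have := rw_ge1 beta gam (boxk u); lra.
Qed.

Lemma normH_le (d : nat) (beta : R) (gam : 'I_d -> R) (f : pt d -> C) (B : R) : 0 <= B ->
  (forall M, Rsum (fun u : {ffun 'I_d -> 'I_(2 * M).+1} =>
     rw beta gam (boxk u) * Cmod (fhat f (boxk u)) ^ 2) <= B ^ 2) ->
  is_finite (normH2 beta gam f) /\ normH beta gam f <= B.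
Proof.
move=> B0 hB.
have [ub lub] := Lub_Rbar_correct (fun s => exists M : nat,
  s = Rsum (fun u : {ffun 'I_d -> 'I_(2 * M).+1} =>
    rw beta gam (boxk u) * Cmod (fhat f (boxk u)) ^ 2)).
rewrite -/(sumZd (fun k => rw beta gam k * Cmod (fhat f k) ^ 2)) in ub lub.
rewrite -/(normH2 beta gam f) in ub lub.
have up : Rbar_le (normH2 beta gam f) (B ^ 2) by apply: lub => s [M ->]; exact: hB.
(* The upper bound excludes [p_infty]; some member of the set is needed to exclude [m_infty]. *)
have lo := ub _ (ex_intro _ 0%N erefl).
have fin : is_finite (normH2 beta gam f).
  by move: up lo; case: (normH2 beta gam f).
split=> //; rewrite /normH -(sqrt_pow2 B) //; apply: sqrt_le_1_alt.
by rewrite -fin in up.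
Qed.

(** * The frequency set K and the first error *)

Section FrequencySet.
Variables (d : nat) (alpha nu : R) (gam : 'I_d -> R).
Hypotheses (alpha_gt1 : 1 < alpha) (gam_bound : forall j, 0 < gam j <= 1) (nu_gt1 : 1 < nu).

Lemma inKP (k : freq d) :
  reflect (forall j, r1 alpha (gam j) (k j) <= nu) (inK alpha nu gam k).
Proof.
rewrite /inK; apply: (iffP (RlebP _ _)) => h; last by apply: Rmaxj_le => //; lra.
by move=> j; apply: Rle_trans h; exact: (Rmaxj_ge (fun j => r1 alpha (gam j) (k j))).
Qed.

(** Guarantees that [sumK], which filters a box, misses no frequency of K. *)
Lemma Kbox_surj (k : freq d) : inK alpha nu gam k ->
  exists u : {ffun 'I_d -> 'I_(2 * Kbox alpha nu gam).+1}, boxk u = k.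
Proof.
move=> /inKP hk; set Kb := Kbox alpha nu gam.
have bd (j : 'I_d) : (Z.abs (k j) <= Z.of_nat Kb)%Z.
  have [g0 g1] := gam_bound j.
  have h := @r1_le_bound alpha (gam j) ltac:(lra) g0 nu (k j) nu_gt1 (hk j).
  have h2 := Rmaxj_ge (fun j => Rpower (nu * gam j) (/ (2 * alpha))) j.
  have [h3 _] := archimed (Rmaxj (fun j => Rpower (nu * gam j) (/ (2 * alpha)))).
  have : IZR (Z.abs (k j)) < IZR (up (Rmaxj (fun j => Rpower (nu * gam j) (/ (2 * alpha))))).
    by rewrite abs_IZR; cbv beta in h2; lra.
  by move/lt_IZR; rewrite /Kb /Kbox; lia.
exists [ffun j => inord (Z.to_nat (k j + Z.of_nat Kb))].
apply: functional_extensionality => j; have := bd j => b.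
by rewrite /boxk ffunE inordK -/Kb; lia.
Qed.

(** With Y = nu^(1/(2 alpha)) >= 1, the radius is at most Y + 1, and 2 (Y + 1) + 1 <= 5 Y. *)
Lemma Kbox_le : (0 < d)%N -> INR (2 * Kbox alpha nu gam).+1 <= 5 * Rpower nu (/ (2 * alpha)).
Proof.
move=> d0; set Y := Rpower nu (/ (2 * alpha)).
have a0 : 0 < / (2 * alpha) by apply: Rinv_0_lt_compat; lra.
have Y1 : 1 <= Y by apply: Rpower_ge1; lra.
set X := Rmaxj (fun j => Rpower (nu * gam j) (/ (2 * alpha))).
have XY : X <= Y.
  apply: Rmaxj_le => [|j]; first lra.
  by apply: Rle_Rpower_l; first lra; have := gam_bound j; nra.
have X0 : 0 < X.
  apply: Rlt_le_trans (Rmaxj_ge (fun j => Rpower (nu * gam j) (/ (2 * alpha))) (Ordinal d0)).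
  exact: Rpower_gt0.
have [h1 h2] := archimed X.
have : (0 < up X)%Z by apply: lt_IZR; lra.
rewrite /Kbox -/X => u0.
rewrite S_INR mult_INR (INR_IZR_INZ (Z.to_nat _)) Z2Nat.id; last lia.
by rewrite -[INR 2]/(1 + 1); lra.
Qed.

(** Union bound over a coordinate j whose weight exceeds nu. For fixed j the sum of products factors
    into one-dimensional sums: a tail in coordinate j, full sums elsewhere. *)
Lemma inK_compl_weight_sum (M : nat) :
  \big[Rplus/0]_(u : {ffun 'I_d -> 'I_(2 * M).+1} | ~~ inK alpha nu gam (boxk u))
    / rw alpha gam (boxk u)
  <= \big[Rplus/0]_(j < d) (2 * tail_cst (2 * alpha) * Rpower (gam j) (/ (2 * alpha) - 1))
     * full_cst (2 * alpha) ^ d * Rpower nu (/ (2 * alpha) - 1).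
Proof.
have a2 : 1 < 2 * alpha by lra.
have A1 := full_cst_ge1 a2; set A := full_cst _ in A1 *.
have a0 : 0 < alpha by lra.
pose q (i : 'I_d) (a : 'I_(2 * M).+1) := / r1 alpha (gam i) (Z.of_nat a - Z.of_nat M).
have q0 i a : 0 <= q i a.
  by left; apply: Rinv_0_lt_compat; have := r1_ge1 alpha (gam i) (Z.of_nat a - Z.of_nat M); lra.
pose big (i : 'I_d) (a : 'I_(2 * M).+1) := Rleb (r1 alpha (gam i) (Z.of_nat a - Z.of_nat M)) nu.
pose q' (j i : 'I_d) a := if i == j then (if big i a then 0 else q i a) else q i a.
have q'0 j i a : 0 <= q' j i a.
  by rewrite /q'; case: ifP => // _; case: ifP => // _; lra.
have rwq (u : {ffun 'I_d -> 'I_(2 * M).+1}) :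
    / rw alpha gam (boxk u) = \big[Rmult/1]_(i < d) q i (u i).
  rewrite /rw /Rprod; apply: (big_ind2 (fun x y => / x = y)) => //.
  - exact: Rinv_1.
  - by move=> x1 x2 y1 y2 <- <-; rewrite Rinv_mult.
apply: Rle_trans (_ : _ <= \big[Rplus/0]_(u : {ffun 'I_d -> 'I_(2 * M).+1}) \big[Rplus/0]_(j < d)
    \big[Rmult/1]_(i < d) q' j i (u i)) _.
  have prod0 (u : {ffun 'I_d -> 'I_(2 * M).+1}) (j : 'I_d) :
    0 <= \big[Rmult/1]_(i < d) q' j i (u i) by exact: big_Rmult_ge0.
  apply: Rle_trans (big_Rplus_pred_le (fun u => ~~ inK alpha nu gam (boxk u)) _); last first.
    by move=> u; apply: big_Rplus_ge0.
  apply: big_Rplus_le => u hu.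
  have [j hj] : exists j, ~~ big j (u j).
    apply/existsP; apply: contraR hu => /existsPn h.
    by apply/inKP => j; apply/RlebP; have := h j; rewrite negbK.
  rewrite (bigD1 j) //= rwq.
  have -> : \big[Rmult/1]_(i < d) q i (u i) = \big[Rmult/1]_(i < d) q' j i (u i).
    by apply: eq_bigr => i _; rewrite /q'; case: eqP => // ->; rewrite (negbTE hj).
  rewrite -[X in X <= _]Rplus_0_r; apply: Rplus_le_compat_l.
  exact: big_Rplus_ge0.
rewrite exchange_big /= Rmult_assoc big_distrl /=; apply: big_Rplus_le => j _.
rewrite -(bigA_distr_bigA (q' j)) (bigD1 j) //= (Rmult_comm (A ^ d)) -Rmult_assoc.
have full i : \big[Rplus/0]_a q i a <= A.
  by have [g0 g1] := gam_bound i; exact: r1_sum_full.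
apply: Rmult_le_compat.
- by apply: big_Rplus_ge0.
- by apply: big_Rmult_ge0 => i _; apply: big_Rplus_ge0.
- have [g0 g1] := gam_bound j.
  have := @r1_sum_tail alpha (gam j) a0 g0 g1 a2 nu M nu_gt1.
  by rewrite /q' eqxx.
- have -> : A ^ d = \big[Rmult/1]_(i < d) A by rewrite big_const card_ord iter_Rmult.
  rewrite [X in _ <= X](bigD1 j) //=.
  (* Only d - 1 full sums remain; [A >= 1] fills the slot of j and gives the exponent d. *)
  apply: Rle_trans (_ : 1 * \big[Rmult/1]_(i < d | i != j) A <= _).
    rewrite Rmult_1_l; apply: big_Rmult_le => i hi; split; first exact: big_Rplus_ge0.
    by rewrite /q' (negbTE hi); exact: full.
  apply: Rmult_le_compat_r => //; apply: big_Rmult_ge0 => *; lra.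
Qed.

Lemma cont_cube_sumK (F : freq d -> pt d -> C) : (forall k, cont_cube (F k)) ->
  cont_cube (fun x => sumK alpha nu gam (fun k => F k x)).
Proof. by move=> Fc; apply: cont_cube_big => u; exact: Fc. Qed.

Variable g : pt d -> C.
Hypothesis g_inH : inH alpha gam g.

Definition fourier_partial (x : pt d) : C :=
  sumK alpha nu gam (fun k => Cmult (fhat g k) (omega k x)).

Lemma cont_cube_partial : cont_cube fourier_partial.
Proof.
apply: (cont_cube_sumK (F := fun k x => Cmult (fhat g k) (omega k x))) => k.
by apply: cont_cube_mult; [exact: cont_cube_const | exact: cont_cube_omega].
Qed.

Lemma fhat_partial (k : freq d) :
  fhat fourier_partial k = if inK alpha nu gam k then fhat g k else RtoC 0.
Proof.
rewrite /fourier_partial /sumK.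
rewrite (fhat_sum _ (F := fun (u : {ffun 'I_d -> 'I_(2 * Kbox alpha nu gam).+1}) x =>
   Cmult (fhat g (boxk u)) (omega (boxk u) x))); last first.
  by move=> u; apply: cont_cube_mult; [exact: cont_cube_const | exact: cont_cube_omega].
have term (u : {ffun 'I_d -> 'I_(2 * Kbox alpha nu gam).+1}) :
  fhat (fun x => Cmult (fhat g (boxk u)) (omega (boxk u) x)) k =
  if [forall j, Z.eqb (k j) (boxk u j)] then fhat g (boxk u) else RtoC 0.
  rewrite fhat_scal ?fhat_omega; last exact: cont_cube_omega.
  by case: ifP => _; rewrite ?Cmult_1_r ?Cmult_0_r.
rewrite /Csum (eq_bigr _ (fun u _ => term u)).
have eqk (u : {ffun 'I_d -> 'I_(2 * Kbox alpha nu gam).+1}) :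
    [forall j, Z.eqb (k j) (boxk u j)] -> boxk u = k.
  by move=> /forallP h; apply: functional_extensionality => j; case: Z.eqb_spec (h j) => // ->.
case: ifP => hk; last first.
  by apply: big1 => u hu; case: ifP => // /eqk e; rewrite e hk in hu.
have [u hu] := Kbox_surj hk.
rewrite (bigD1 u) ?hu //= big1.
  by rewrite Cplus_0_r; case: forallP => // -[] j; rewrite Z.eqb_refl.
move=> v /andP [_ vu]; case: ifP => // /eqk e.
by case/eqP: vu; apply: boxk_inj; rewrite e hu.
Qed.

Lemma partial_error (B : R) (x : pt d) : 0 <= B ->
  (forall M, \big[Rplus/0]_(u : {ffun 'I_d -> 'I_(2 * M).+1} | ~~ inK alpha nu gam (boxk u))
    / rw alpha gam (boxk u) <= B) ->
  in_cube x -> Cmod (Cminus (g x) (fourier_partial x)) <= normH alpha gam g * sqrt B.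
Proof.
have [gc fin] := g_inH.
move=> B0 hB hx.
have cd : cont_cube (fun x => Cplus (g x) (Cmult (RtoC (-1)) (fourier_partial x))).
  apply: cont_cube_plus => //; apply: cont_cube_mult; first exact: cont_cube_const.
  exact: cont_cube_partial.
have -> : Cminus (g x) (fourier_partial x) = Cplus (g x) (Cmult (RtoC (-1)) (fourier_partial x)).
  have -> : RtoC (-1) = Copp (RtoC 1) by rewrite /RtoC /Copp /=; congr pair; ring.
  ring.
apply: (sup_le_fourier_l1 cd) => // M.
have term k : Cmod (fhat (fun x => Cplus (g x) (Cmult (RtoC (-1)) (fourier_partial x))) k) =
    if inK alpha nu gam k then 0 else Cmod (fhat g k).
  rewrite fhat_plus // ?fhat_scal ?fhat_partial; last 2 first.
  - exact: cont_cube_partial.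
  - by apply: cont_cube_mult; [exact: cont_cube_const | exact: cont_cube_partial].
  have -> : RtoC (-1) = Copp (RtoC 1) by rewrite /RtoC /Copp /=; congr pair; ring.
  case: ifP => _; last by congr Cmod; ring.
  by rewrite -Cmod_0; congr Cmod; ring.
(* Each coefficient is written as (sqrt r |g^|) (1 / sqrt r), ready for Cauchy-Schwarz. *)
have -> : Rsum (fun u : {ffun 'I_d -> 'I_(2 * M).+1} => Cmod (fhat
    (fun x => Cplus (g x) (Cmult (RtoC (-1)) (fourier_partial x))) (boxk u))) =
  \big[Rplus/0]_(u : {ffun 'I_d -> 'I_(2 * M).+1} | ~~ inK alpha nu gam (boxk u))
    (sqrt (rw alpha gam (boxk u)) * Cmod (fhat g (boxk u)) * sqrt (/ rw alpha gam (boxk u))).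
  rewrite /Rsum [RHS]big_mkcond /=; apply: eq_bigr => u _; rewrite term.
  case: ifP => _ //=; have r1 := rw_ge1 alpha gam (boxk u).
  have -> : sqrt (rw alpha gam (boxk u)) * Cmod (fhat g (boxk u)) * sqrt (/ rw alpha gam (boxk u))
     = Cmod (fhat g (boxk u)) * (sqrt (rw alpha gam (boxk u)) * sqrt (/ rw alpha gam (boxk u))).
    by ring.
  rewrite -sqrt_mult; [|lra|by left; apply: Rinv_0_lt_compat; lra].
  by rewrite Rinv_r ?sqrt_1; lra.
rewrite /normH -sqrt_mult //; last exact: normH2_ge0.
apply: Rsqr_incr_0_var; last exact: sqrt_pos.
rewrite Rsqr_sqrt; last by apply: Rmult_le_pos => //; exact: normH2_ge0.
rewrite Rsqr_pow2; apply: Rle_trans (cauchy_schwarz_sum _ _ _ _) _.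
apply: Rmult_le_compat.
- by apply: big_Rplus_ge0 => *; exact: pow2_ge_0.
- by apply: big_Rplus_ge0 => *; exact: pow2_ge_0.
- apply: Rle_trans (box_sum_le_normH2 M fin); rewrite /Rsum.
  apply: Rle_trans (big_Rplus_pred_le (fun u => ~~ inK alpha nu gam (boxk u)) _); last first.
    move=> u; apply: Rmult_le_pos; last exact: pow2_ge_0.
    by have := rw_ge1 alpha gam (boxk u); lra.
  apply: big_Rplus_le => u _; rewrite Rpow_mult_distr pow2_sqrt; first lra.
  by have := rw_ge1 alpha gam (boxk u); lra.
- apply: Rle_trans (hB M); apply: big_Rplus_le => u _; rewrite pow2_sqrt; first lra.
  by left; apply: Rinv_0_lt_compat; have := rw_ge1 alpha gam (boxk u); lra.
Qed.

Variables (N : nat) (xs : 'I_N -> pt d) (c : 'I_N -> R).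
Hypotheses (N_gt0 : (0 < N)%N) (xs_cube : forall n, in_cube (xs n)).

Lemma mubar_ge0 : 0 <= mubar c.
Proof.
apply: Rmult_le_pos; first by left; apply: Rinv_0_lt_compat; apply: lt_0_INR; lia.
by apply: big_Rplus_ge0 => n _; exact: Rabs_pos.
Qed.

(** The source of [mubar] in both errors: it bounds the coefficients of phi_K and the mean of the
    truncation errors at the nodes. *)
Lemma weighted_mean_bound (F : 'I_N -> C) (B : R) : (forall n, Cmod (F n) <= B) ->
  Cmod (Cmult (RtoC (/ INR N)) (Csum predT (fun n => Cmult (RtoC (c n)) (F n)))) <= B * mubar c.
Proof.
move=> hF; have N0 : 0 < / INR N by apply: Rinv_0_lt_compat; apply: lt_0_INR; lia.
rewrite Cmod_mult Cmod_R Rabs_pos_eq; last lra.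
rewrite /mubar (Rmult_comm B) Rmult_assoc; apply: Rmult_le_compat_l; first lra.
apply: Rle_trans (Cmod_big_le _ _ _) _; rewrite /Rsum big_distrl /=.
apply: big_Rplus_le => n _; rewrite Cmod_mult Cmod_R.
by apply: Rmult_le_compat_l; [exact: Rabs_pos | exact: hF].
Qed.

Lemma phicheck_bound (k : freq d) : Cmod (phicheck xs c k) <= mubar c.
Proof.
rewrite -[X in _ <= X]Rmult_1_l; apply: weighted_mean_bound => n.
rewrite Cmod_omega; lra.
Qed.

Lemma cont_cube_phi_term (k : freq d) :
  cont_cube (fun x => Cmult (phicheck xs c k) (Cmult (g x) (Cconj (omega k x)))).
Proof.
have [gc _] := g_inH; apply: cont_cube_mult; first exact: cont_cube_const.
exact: cont_cube_fhat.
Qed.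

Lemma g_phiK (x : pt d) : Cmult (g x) (phiK alpha nu gam xs c x) =
  sumK alpha nu gam (fun k => Cmult (phicheck xs c k) (Cmult (g x) (Cconj (omega k x)))).
Proof. by rewrite /phiK /sumK /Csum big_distrr /=; apply: eq_bigr => u _; ring. Qed.

(** Integration against the conjugate character produces g^_k, while the coefficient of phi_K
    carries omega_k(x_n). Hence [err1] is a weighted mean of g minus its partial sum at the
    nodes. *)
Lemma int_g_phiK : intd (fun x => Cmult (g x) (phiK alpha nu gam xs c x)) =
  Cmult (RtoC (/ INR N)) (Csum predT (fun n => Cmult (RtoC (c n)) (fourier_partial (xs n)))).
Proof.
have [gc _] := g_inH.
transitivity (intd (fun x => sumK alpha nu gam (fun k =>
   Cmult (phicheck xs c k) (Cmult (g x) (Cconj (omega k x)))))).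
  by apply: intd_ext => x _; exact: g_phiK.
rewrite /sumK (intd_sum _ (F := fun (u : {ffun 'I_d -> 'I_(2 * Kbox alpha nu gam).+1}) x =>
   Cmult (phicheck xs c (boxk u)) (Cmult (g x) (Cconj (omega (boxk u) x))))); last first.
  by move=> u; exact: cont_cube_phi_term.
rewrite /Csum.
rewrite (eq_bigr (fun u : {ffun 'I_d -> 'I_(2 * Kbox alpha nu gam).+1} =>
  \big[Cplus/RtoC 0]_(n < N) Cmult (RtoC (/ INR N)) (Cmult (RtoC (c n))
     (Cmult (fhat g (boxk u)) (omega (boxk u) (xs n)))))); last first.
  move=> u _; rewrite intd_scal; last exact: cont_cube_fhat.
  rewrite -/(fhat g (boxk u)) /phicheck /Csum -Cmult_assoc -[RHS]big_distrr /= big_distrl /=.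
  by congr Cmult; apply: eq_bigr => n _; ring.
rewrite exchange_big /= big_distrr /=; apply: eq_bigr => n _.
by rewrite /fourier_partial /sumK /Csum !big_distrr.
Qed.

Lemma err1_bound (B : R) : 0 <= B ->
  (forall M, \big[Rplus/0]_(u : {ffun 'I_d -> 'I_(2 * M).+1} | ~~ inK alpha nu gam (boxk u))
    / rw alpha gam (boxk u) <= B) ->
  err1 alpha nu gam xs c g <= normH alpha gam g * sqrt B * mubar c.
Proof.
move=> B0 hB; rewrite /err1 int_g_phiK.
set S1 := Csum _ _; set S2 := Csum _ _.
have -> : Cminus (Cmult (RtoC (/ INR N)) S1) (Cmult (RtoC (/ INR N)) S2) =
  Cmult (RtoC (/ INR N)) (Csum predT (fun n => Cmult (RtoC (c n))
    (Cminus (g (xs n)) (fourier_partial (xs n))))).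
  have -> : Cminus (Cmult (RtoC (/ INR N)) S1) (Cmult (RtoC (/ INR N)) S2) =
     Cmult (RtoC (/ INR N)) (Cplus S1 (Cmult (Copp (RtoC 1)) S2)) by ring.
  congr Cmult; rewrite /S1 /S2 /Csum big_distrr -big_split /=.
  by apply: eq_bigr => n _; ring.
by apply: weighted_mean_bound => n; apply: partial_error.
Qed.

End FrequencySet.

(** * Comparison of weights for different smoothness and shifted frequencies *)

Section WeightComparison.
Variables (alpha beta gam : R).
Hypotheses (beta_gt0 : 0 < beta) (beta_le : beta <= alpha) (gam_gt0 : 0 < gam) (gam_le1 : gam <= 1).

Lemma r1_nonzero (b : R) (h : Z) : h <> 0%Z ->
  1 <= Rabs (IZR h) /\ r1 b gam h = Rmax (Rpower (Rabs (IZR h)) (2 * b) / gam) 1.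
Proof.
move=> h0; have h1 : 1 <= Rabs (IZR h) by rewrite -abs_IZR; apply: IZR_le; lia.
by split=> //; rewrite /r1 rpowE //; lra.
Qed.

Lemma r1_mono (h : Z) : r1 beta gam h <= r1 alpha gam h.
Proof.
case: (Z.eq_dec h 0) => [->|h0]; first by rewrite !r1_0; lra.
have [h1 ->] := r1_nonzero beta h0; have [_ ->] := r1_nonzero alpha h0.
apply: Rle_max_compat_r; apply: Rmult_le_compat_r; first by left; exact: Rinv_0_lt_compat.
by apply: Rle_Rpower; lra.
Qed.

Lemma r1_submul (a b : Z) :
  r1 beta gam a <= Rpower 2 (2 * alpha) * (r1 beta gam (a + b) * r1 beta gam b).
Proof.
have c1 : 1 <= Rpower 2 (2 * alpha) by apply: Rpower_ge1; lra.
have ra := r1_ge1 beta gam (a + b); have rb := r1_ge1 beta gam b.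
have rab : 1 <= r1 beta gam (a + b) * r1 beta gam b by nra.
case: (Z.eq_dec a 0) => [->|a0]; first by rewrite {1}r1_0; rewrite /= in rab *; nra.
have [a1 ->] := r1_nonzero beta a0.
apply: Rmax_lub; last nra.
(* By the triangle inequality |a| is at most twice the larger of |a + b| and |b|; [key] is applied
   to that one, and the other weight is at least 1. *)
have key (m : Z) : Rabs (IZR a) <= 2 * Rabs (IZR m) ->
    Rpower (Rabs (IZR a)) (2 * beta) / gam <= Rpower 2 (2 * alpha) * r1 beta gam m.
  move=> ham; have m0 : m <> 0%Z by move=> m0; rewrite m0 Rabs_R0 in ham; lra.
  have [m1 ->] := r1_nonzero beta m0.
  apply: Rle_trans (_ : Rpower 2 (2 * alpha) * (Rpower (Rabs (IZR m)) (2 * beta) / gam) <= _).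
    rewrite /Rdiv -Rmult_assoc; apply: Rmult_le_compat_r.
      by left; exact: Rinv_0_lt_compat.
    apply: Rle_trans (_ : Rpower 2 (2 * beta) * Rpower (Rabs (IZR m)) (2 * beta) <= _).
      rewrite Rpower_mult_distr; [|lra|lra].
      by apply: Rle_Rpower_l; lra.
    apply: Rmult_le_compat_r; first by left; exact: Rpower_gt0.
    by apply: Rle_Rpower; lra.
  by apply: Rmult_le_compat_l; [lra | exact: Rmax_l].
have tri : Rabs (IZR a) <= Rabs (IZR (a + b)) + Rabs (IZR b).
  have -> : IZR a = IZR (a + b) - IZR b by rewrite plus_IZR; ring.
  by apply: Rle_trans (Rabs_triang _ _) _; rewrite Rabs_Ropp; lra.
case: (Rle_dec (Rabs (IZR (a + b))) (Rabs (IZR b))) => hab.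
  apply: Rle_trans (key b ltac:(lra)) _; apply: Rmult_le_compat_l; nra.
apply: Rle_trans (key (a + b)%Z ltac:(lra)) _; apply: Rmult_le_compat_l; nra.
Qed.

(** On K one has |h| <= nu^(1/(2 alpha)), and 2 beta <= 2 alpha - 1 gives |h|^(2 beta) <= nu^(1 -
    1/(2 alpha)). *)
Lemma r1_le_of_inK (nu : R) (h : Z) : / 2 < alpha -> beta <= alpha - / 2 -> 1 < nu ->
  r1 alpha gam h <= nu -> r1 beta gam h <= Rpower nu (1 - / (2 * alpha)) * / gam.
Proof.
move=> a2 b2 nu1 hr.
have ia : 0 < / (2 * alpha) by apply: Rinv_0_lt_compat; lra.
have ia1 : / (2 * alpha) <= 1 by rewrite -Rinv_1; apply: Rinv_le_contravar; lra.
have g1 : 1 <= / gam by rewrite -Rinv_1; apply: Rinv_le_contravar; lra.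
have p1 : 1 <= Rpower nu (1 - / (2 * alpha)) by apply: Rpower_ge1; lra.
have one : 1 <= Rpower nu (1 - / (2 * alpha)) * / gam by nra.
case: (Z.eq_dec h 0) => [->|h0]; first by rewrite r1_0.
have [h1 ->] := r1_nonzero beta h0; apply: Rmax_lub => //.
apply: Rmult_le_compat_r; first lra.
have hb := @r1_le_bound alpha gam ltac:(lra) gam_gt0 nu h nu1 hr.
have hb2 : Rabs (IZR h) <= Rpower nu (/ (2 * alpha)).
  by apply: Rle_trans hb _; apply: Rle_Rpower_l; [lra | nra].
apply: Rle_trans (_ : Rpower (Rabs (IZR h)) (2 * alpha - 1) <= _).
  by apply: Rle_Rpower; lra.
have -> : Rpower nu (1 - / (2 * alpha)) = Rpower (Rpower nu (/ (2 * alpha))) (2 * alpha - 1).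
  by rewrite Rpower_mult; congr Rpower; field; lra.
by apply: Rle_Rpower_l; lra.
Qed.

End WeightComparison.

Lemma Rprod_mult (d : nat) (F G : 'I_d -> R) : Rprod (fun j => F j * G j) = Rprod F * Rprod G.
Proof. by rewrite /Rprod big_split. Qed.

Lemma Rprod_const (d : nat) (x : R) : Rprod (fun _ : 'I_d => x) = x ^ d.
Proof. by rewrite /Rprod big_const card_ord iter_Rmult. Qed.

(** * The norm of g phi_K and the second error *)

Section BoxShift.
Variables (d M K : nat) (v : {ffun 'I_d -> 'I_(2 * K).+1}).

(** With radius M + K, adding indices adds frequencies: (u - M) + (v - K) = (u + v) - (M + K). *)
Definition box_shift (u : {ffun 'I_d -> 'I_(2 * M).+1}) : {ffun 'I_d -> 'I_(2 * (M + K)).+1} :=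
  [ffun j => inord (u j + v j)].

Lemma boxk_shift u : boxk (box_shift u) = (fun j => (boxk u j + boxk v j)%Z).
Proof.
apply: functional_extensionality => j; rewrite /boxk ffunE inordK; first lia.
by have := ltn_ord (u j); have := ltn_ord (v j); lia.
Qed.

Lemma box_shift_inj : injective box_shift.
Proof.
move=> u u' e; apply: boxk_inj; apply: functional_extensionality => j.
have := f_equal (fun w => boxk w j) e; rewrite !boxk_shift; lia.
Qed.

End BoxShift.

Lemma lattice_error_bound (d L : nat) (beta : R) (gam : 'I_d -> R) (gen : 'I_d -> nat)
    (f : pt d -> C) (B W : R) : cont_cube f -> 0 <= B -> 0 <= W ->
  Rbar_le (wce L beta gam gen) W ->
  (forall M, Rsum (fun u : {ffun 'I_d -> 'I_(2 * M).+1} =>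
     rw beta gam (boxk u) * Cmod (fhat f (boxk u)) ^ 2) <= B ^ 2) ->
  Cmod (Cminus (intd f) (Qlat L gen f)) <= B * W.
Proof.
move=> fc B0 W0 hW hB.
apply: le_epsilon => eps e0.
(* The function is scaled into the unit ball. [B] may be zero, so it is enlarged first; the
   enlargement costs at most [eps] after multiplication by [W]. *)
set B' := B + eps / (W + 1).
have q0 : 0 < eps / (W + 1) by apply: Rdiv_lt_0_compat; lra.
have B'0 : 0 < B' by rewrite /B'; lra.
have iB : 0 < / B' by exact: Rinv_0_lt_compat.
pose f' x := Cmult (RtoC (/ B')) (f x).
have f'c : cont_cube f' by apply: cont_cube_mult => //; exact: cont_cube_const.
have [fin n1] : is_finite (normH2 beta gam f') /\ normH beta gam f' <= 1.
  apply: normH_le; first lra.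
  move=> M; apply: Rle_trans (_ : (/ B') ^ 2 * B ^ 2 <= _); last first.
    have : / B' * B <= 1.
      by rewrite -(Rinv_l B'); [apply: Rmult_le_compat_l; [lra | rewrite /B'; lra] | lra].
    have : 0 <= / B' * B by nra.
    nra.
  apply: Rle_trans (Rmult_le_compat_l _ _ _ (pow2_ge_0 _) (hB M)).
  rewrite /Rsum big_distrr /=; right; apply: eq_bigr => u _.
  rewrite /f' fhat_scal // Cmod_mult Cmod_R Rabs_pos_eq; last lra.
  ring.
have [ub _] := Lub_Rbar_correct (fun e => exists f : pt d -> C,
    inH beta gam f /\ normH beta gam f <= 1 /\ e = Cmod (Cminus (intd f) (Qlat L gen f))).
have := ub _ (ex_intro _ f' (conj (conj f'c fin) (conj n1 erefl))).
rewrite -/(wce L beta gam gen) => /Rbar_le_trans /(_ hW) /=.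
have -> : Cminus (intd f') (Qlat L gen f') =
   Cmult (RtoC (/ B')) (Cminus (intd f) (Qlat L gen f)).
  rewrite /f' intd_scal //.
  have -> : Qlat L gen (fun x => Cmult (RtoC (/ B')) (f x)) = Cmult (RtoC (/ B')) (Qlat L gen f).
    by rewrite /Qlat /Csum -big_distrr /=; ring.
  ring.
rewrite Cmod_mult Cmod_R Rabs_pos_eq; last lra.
set E := Cmod _ => hE.
have : E <= B' * W.
  have := Rmult_le_compat_l B' _ _ ltac:(lra) hE.
  by rewrite -Rmult_assoc Rinv_r; lra.
have : eps / (W + 1) * W <= eps.
  have -> : eps / (W + 1) * W = eps * (W / (W + 1)) by field; lra.
  have : W / (W + 1) <= 1 by apply/Rle_div_l; lra.
  nra.
rewrite /B'; lra.
Qed.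

Section ProductNorm.
Variables (d : nat) (alpha beta nu : R) (gam : 'I_d -> R).
Hypotheses (alpha_gt1 : 1 < alpha) (gam_bound : forall j, 0 < gam j <= 1) (nu_gt1 : 1 < nu).
Hypotheses (beta_gt0 : 0 < beta) (beta_le : beta <= alpha - / 2).

Lemma rw_mono (k : freq d) : rw beta gam k <= rw alpha gam k.
Proof.
apply: big_Rmult_le => j _; have [g0 g1] := gam_bound j.
split; first by have := r1_ge1 beta (gam j) (k j); lra.
by apply: r1_mono => //; lra.
Qed.

Lemma rw_shift (k l : freq d) : inK alpha nu gam l ->
  rw beta gam k <= (Rpower 2 (2 * alpha) * Rpower nu (1 - / (2 * alpha))) ^ d *
    Rprod (fun j => / gam j) * rw alpha gam (fun j => (k j + l j)%Z).
Proof.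
move=> /(inKP alpha gam nu_gt1) hl.
rewrite -Rprod_const -Rprod_mult; apply: Rle_trans (_ : _ <= Rprod (fun j =>
   Rpower 2 (2 * alpha) * Rpower nu (1 - / (2 * alpha)) * / gam j) *
     rw beta gam (fun j => (k j + l j)%Z)) _; last first.
  apply: Rmult_le_compat_l; last exact: rw_mono.
  apply: big_Rmult_ge0 => j _; have [g0 g1] := gam_bound j.
  have := Rinv_0_lt_compat _ g0.
  have := Rpower_gt0 2 (2 * alpha); have := Rpower_gt0 nu (1 - / (2 * alpha)) => *.
  by left; do 2?apply: Rmult_lt_0_compat.
rewrite /rw -Rprod_mult; apply: big_Rmult_le => j _; have [g0 g1] := gam_bound j.
have rk := r1_ge1 beta (gam j) (k j); split; first lra.
have rkl := r1_ge1 beta (gam j) (k j + l j).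
have := @r1_submul alpha beta (gam j) beta_gt0 ltac:(lra) g0 (k j) (l j).
have h1 : r1 beta (gam j) (l j) <= Rpower nu (1 - / (2 * alpha)) * / gam j.
  by apply: r1_le_of_inK => //; lra.
move=> h2; apply: Rle_trans h2 _.
have c0 := Rpower_gt0 2 (2 * alpha).
rewrite !Rmult_assoc; apply: Rmult_le_compat_l; first lra.
rewrite Rmult_comm -Rmult_assoc; apply: Rmult_le_compat_r => //; lra.
Qed.

(** 25 is the square of the 5 in the box size, which enters twice; 2^(2 alpha) comes from shifting
    the weight and 1/gamma_j from its bound on K. *)
Definition product_cst : R :=
  (25 * Rpower 2 (2 * alpha)) ^ d * Rprod (fun j => / gam j).

Lemma product_cst_gt0 : 0 < product_cst.
Proof.
apply: Rmult_lt_0_compat; first by apply: pow_lt; have := Rpower_gt0 2 (2 * alpha); lra.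
by apply: big_Rmult_gt0 => j _; apply: Rinv_0_lt_compat; have := gam_bound j; lra.
Qed.

Lemma card_Kbox :
  INR #|{: {ffun 'I_d -> 'I_(2 * Kbox alpha nu gam).+1}}| <= (5 * Rpower nu (/ (2 * alpha))) ^ d.
Proof.
rewrite card_ffun !card_ord.
have INR_exp (m n : nat) : INR (m ^ n)%N = INR m ^ n.
  by elim: n => [|n IH] //; rewrite expnS mult_INR IH.
rewrite INR_exp.
case: (posnP d) => [e|d0]; first by set a := INR _; set b := 5 * _; rewrite e /=; lra.
by apply: pow_incr; split; [exact: pos_INR | exact: Kbox_le].
Qed.

Variable g : pt d -> C.
Hypothesis g_inH : inH alpha gam g.
Variables (N : nat) (xs : 'I_N -> pt d) (c : 'I_N -> R).
Hypothesis N_gt0 : (0 < N)%N.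

Let gphi (x : pt d) : C := Cmult (g x) (phiK alpha nu gam xs c x).

Lemma cont_cube_gphi : cont_cube gphi.
Proof.
have -> : gphi = (fun x => sumK alpha nu gam (fun k =>
   Cmult (phicheck xs c k) (Cmult (g x) (Cconj (omega k x))))).
  by apply: functional_extensionality => x; exact: g_phiK.
apply: (cont_cube_sumK alpha nu gam (F := fun k x =>
   Cmult (phicheck xs c k) (Cmult (g x) (Cconj (omega k x))))) => k.
exact: (cont_cube_phi_term g_inH).
Qed.

Lemma fhat_gphi (k : freq d) : fhat gphi k =
  sumK alpha nu gam (fun l => Cmult (phicheck xs c l) (fhat g (fun j => (k j + l j)%Z))).
Proof.
have [gc _] := g_inH.
have -> : gphi = (fun x => sumK alpha nu gam (fun k =>
   Cmult (phicheck xs c k) (Cmult (g x) (Cconj (omega k x))))).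
  by apply: functional_extensionality => x; exact: g_phiK.
rewrite /sumK (fhat_sum _ (F := fun (u : {ffun 'I_d -> 'I_(2 * Kbox alpha nu gam).+1}) x =>
   Cmult (phicheck xs c (boxk u)) (Cmult (g x) (Cconj (omega (boxk u) x))))); last first.
  by move=> u; exact: (cont_cube_phi_term g_inH).
apply: eq_bigr => u _; rewrite fhat_scal; last exact: cont_cube_fhat.
by rewrite fhat_mul_conj_omega.
Qed.

Lemma normH_gphi (M : nat) :
  Rsum (fun u : {ffun 'I_d -> 'I_(2 * M).+1} =>
     rw beta gam (boxk u) * Cmod (fhat gphi (boxk u)) ^ 2)
  <= (sqrt product_cst * Rpower nu ((/ 2 + / (4 * alpha)) * INR d)
      * normH alpha gam g * mubar c) ^ 2.
Proof.
have [gc fin] := g_inH.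
set Kb := Kbox alpha nu gam.
set n := INR #|{: {ffun 'I_d -> 'I_(2 * Kb).+1}}|.
have n0 : 0 <= n by exact: pos_INR.
have mu0 := mubar_ge0 c N_gt0.
pose sh (k l : freq d) : freq d := fun j => (k j + l j)%Z.
set D := (Rpower 2 (2 * alpha) * Rpower nu (1 - / (2 * alpha))) ^ d * Rprod (fun j => / gam j).
have D0 : 0 <= D.
  apply: Rmult_le_pos.
    by apply: pow_le; left; apply: Rmult_lt_0_compat; exact: Rpower_gt0.
  by apply: big_Rmult_ge0 => j _; left; apply: Rinv_0_lt_compat; have := gam_bound j; lra.
have G0 := normH2_ge0 fin; set G2 := real _ in G0.
have rw0 b k : 0 <= rw b gam k by have := rw_ge1 b gam k; lra.
have pointwise k : Cmod (fhat gphi k) ^ 2 <= mubar c ^ 2 * n *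
   \big[Rplus/0]_(v : {ffun 'I_d -> 'I_(2 * Kb).+1} | inK alpha nu gam (boxk v))
      Cmod (fhat g (sh k (boxk v))) ^ 2.
  rewrite fhat_gphi.
  set S1 := \big[Rplus/0]_(v : {ffun 'I_d -> 'I_(2 * Kb).+1} | inK alpha nu gam (boxk v))
     (1 * Cmod (fhat g (sh k (boxk v)))).
  have h1 : Cmod (sumK alpha nu gam (fun l =>
      Cmult (phicheck xs c l) (fhat g (fun j => (k j + l j)%Z)))) <= mubar c * S1.
    apply: Rle_trans (Cmod_big_le _ _ _) _; rewrite /S1 big_distrr /=.
    apply: big_Rplus_le => v _; rewrite Cmod_mult Rmult_1_l.
    by apply: Rmult_le_compat_r; [exact: Cmod_ge_0 | exact: phicheck_bound].
  have h2 := cauchy_schwarz_sum (index_enum _)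
     (fun v : {ffun 'I_d -> 'I_(2 * Kb).+1} => inK alpha nu gam (boxk v))
     (fun _ => 1) (fun v => Cmod (fhat g (sh k (boxk v)))).
  rewrite -/S1 in h2.
  apply: Rle_trans (pow_incr _ _ 2 (conj (Cmod_ge_0 _) h1)) _.
  rewrite Rpow_mult_distr Rmult_assoc; apply: Rmult_le_compat_l; first exact: pow2_ge_0.
  apply: Rle_trans h2 _; apply: Rmult_le_compat_r.
    by apply: big_Rplus_ge0 => *; exact: pow2_ge_0.
  apply: Rle_trans (big_Rplus_pred_le _ _) _; first by move=> _; lra.
  by rewrite big_Rplus_const -/n; lra.
have shifted (v : {ffun 'I_d -> 'I_(2 * Kb).+1}) : inK alpha nu gam (boxk v) ->
  \big[Rplus/0]_(u : {ffun 'I_d -> 'I_(2 * M).+1})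
     (rw beta gam (boxk u) * Cmod (fhat g (sh (boxk u) (boxk v))) ^ 2) <= D * G2.
  (* The shifted box lies in the box of radius [M + Kb], whose weighted sum is bounded by the
     squared norm of g. *)
  move=> hv; apply: Rle_trans (Rmult_le_compat_l _ _ _ D0 (box_sum_le_normH2 (M + Kb) fin)).
  apply: Rle_trans (Rmult_le_compat_l _ _ _ D0 (big_Rplus_inj_le (F := fun w =>
    rw alpha gam (boxk w) * Cmod (fhat g (boxk w)) ^ 2) (@box_shift_inj d M Kb v) _)); last first.
    by move=> w; apply: Rmult_le_pos => //; exact: pow2_ge_0.
  rewrite big_distrr /=; apply: big_Rplus_le => u _; rewrite boxk_shift -(Rmult_assoc D).
  apply: Rmult_le_compat_r; first exact: pow2_ge_0.
  exact: rw_shift.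
(* One factor [n] comes from Cauchy-Schwarz, the other counts the shifts. *)
apply: Rle_trans (_ : mubar c ^ 2 * n * (n * (D * G2)) <= _).
  apply: Rle_trans (_ : \big[Rplus/0]_(u : {ffun 'I_d -> 'I_(2 * M).+1})
     (mubar c ^ 2 * n *
      \big[Rplus/0]_(v : {ffun 'I_d -> 'I_(2 * Kb).+1} | inK alpha nu gam (boxk v))
      (rw beta gam (boxk u) * Cmod (fhat g (sh (boxk u) (boxk v))) ^ 2)) <= _).
    apply: big_Rplus_le => u _.
    apply: Rle_trans (Rmult_le_compat_l _ _ _ (rw0 _ _) (pointwise _)) _; right.
    by rewrite -(big_distrr (rw beta gam (boxk u))) /=; ring.
  rewrite -big_distrr /=; apply: Rmult_le_compat_l.
    by apply: Rmult_le_pos => //; exact: pow2_ge_0.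
  rewrite exchange_big /= -big_Rplus_const.
  apply: Rle_trans (big_Rplus_pred_le (fun v => inK alpha nu gam (boxk v)) _); last first.
    by move=> _; exact: Rmult_le_pos.
  exact: big_Rplus_le.
set X := Rpower nu _.
have X2 : X ^ 2 = (Rpower nu (/ (2 * alpha)) ^ 2 * Rpower nu (1 - / (2 * alpha))) ^ d.
  rewrite /X -!Rpower_pow; try exact: Rpower_gt0; last first.
    by apply: Rmult_lt_0_compat; exact: Rpower_gt0.
  rewrite !Rpower_mult -Rpower_plus Rpower_mult; congr Rpower.
  by rewrite -[INR 2]/(1 + 1); field; lra.
have -> : (sqrt product_cst * X * normH alpha gam g * mubar c) ^ 2 =
   mubar c ^ 2 * (((5 * Rpower nu (/ (2 * alpha))) ^ d) ^ 2 * (D * G2)).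
  rewrite !Rpow_mult_distr pow2_sqrt; last by left; exact: product_cst_gt0.
  rewrite X2 /normH pow2_sqrt // -/G2 /product_cst /D !Rpow_mult_distr.
  have -> : 25 = 5 ^ 2 by ring.
  have sw x : (x ^ 2) ^ d = (x ^ d) ^ 2 by rewrite -!pow_mult Nat.mul_comm.
  rewrite !sw pow1; ring.
rewrite Rmult_assoc; apply: Rmult_le_compat_l; first exact: pow2_ge_0.
rewrite -Rmult_assoc; apply: Rmult_le_compat_r; first exact: Rmult_le_pos.
have := card_Kbox; rewrite -/Kb -/n; nra.
Qed.

Lemma err2_bound (L : nat) (gen : 'I_d -> nat) (W : R) : 0 <= W ->
  Rbar_le (wce L beta gam gen) W ->
  err2 L alpha nu gam xs c gen g <=
  sqrt product_cst * Rpower nu ((/ 2 + / (4 * alpha)) * INR d)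
      * normH alpha gam g * mubar c * W.
Proof.
move=> W0 hW; apply: (lattice_error_bound cont_cube_gphi) hW normH_gphi => //.
have := mubar_ge0 c N_gt0; have := sqrt_pos product_cst => s0 m0.
have X0 := Rpower_gt0 nu ((/ 2 + / (4 * alpha)) * INR d).
have g0 : 0 <= normH alpha gam g by exact: sqrt_pos.
by apply: Rmult_le_pos => //; apply: Rmult_le_pos => //; apply: Rmult_le_pos; lra.
Qed.

End ProductNorm.

(** Covers divergent series too: [Series] applies [real] to the limit, and [real] sends [p_infty] to
    0. *)
Lemma zeta_ge0 (s : R) : 0 <= zeta s.
Proof.
have : Rbar_le (Lim_seq (fun _ => 0)) (Lim_seq (sum_n (fun n => / Rpower (INR n.+1) s))).
  apply: Lim_seq_le_loc; exists 0%N => n _.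
  elim: n => [|n IH]; rewrite ?sum_O ?sum_Sn /plus /=.
    by left; apply: Rinv_0_lt_compat; exact: Rpower_gt0.
  apply: Rplus_le_le_0_compat => //.
  by left; apply: Rinv_0_lt_compat; exact: Rpower_gt0.
by rewrite Lim_seq_const /zeta /Series; case: (Lim_seq _) => //=; lra.
Qed.

Lemma zetadd_ge1 (delta : R) (d : nat) : 1 <= zetadd delta d.
Proof.
apply: Rpower_ge1; first by have := zeta_ge0 (1 + 2 * delta); lra.
by have := pos_INR d; lra.
Qed.

Lemma cagd_ge1 (d : nat) (alpha : R) (gam : 'I_d -> R) : 1 <= cagd alpha gam.
Proof.
rewrite -sqrt_1; apply: sqrt_le_1_alt.
by apply: big_Rmult_ge1 => j _; exact: Rmax_l.
Qed.

Lemma Cgd_gt0 (d : nat) (gam : 'I_d -> R) (beta tau : R) : 0 < Cgd gam beta tau.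
Proof.
apply: Rmult_lt_0_compat; first exact: Rpower_gt0.
by apply: big_Rmult_gt0 => j _; exact: Rpower_gt0.
Qed.

Theorem theorem3p15 (alpha : R) (d : nat) (gam : 'I_d -> R) :
  1 < alpha ->
  (forall j, 0 < gam j <= 1) ->
  (forall i j : 'I_d, (i <= j)%N -> gam j <= gam i) ->
  exists Cst : R, 0 < Cst /\
  forall (delta tau : R) (g : pt d -> C) (N : nat) (xs : 'I_N -> pt d)
         (c : 'I_N -> R) (L : nat) (gen : 'I_d -> nat) (nu : R),
    0 < delta < alpha - 1 ->
    0 < tau <= alpha - 1 - delta ->
    inH alpha gam g ->
    (0 < N)%N ->
    (forall n, in_cube (xs n)) ->
    prime L ->
    (forall j, (1 <= gen j <= L.-1)%N) ->
    (forall tau', 0 < tau' <= (alpha - /2 - delta) - /2 ->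
       Rbar_le (wce L (alpha - /2 - delta) gam gen)
               (Cgd gam (alpha - /2 - delta) tau'
                * Rpower (INR L) (- (alpha - /2 - delta) + tau'))) ->
    1 < nu ->
    err1 alpha nu gam xs c g + err2 L alpha nu gam xs c gen g
    <= Cst * normH alpha gam g *
       (/ Rpower nu (/2 - / (4 * alpha))
        + Rpower nu ((/2 + / (4 * alpha)) * INR d)
          / Rpower (INR L) (alpha - /2 - delta - tau)
          * cagd alpha gam * zetadd delta d
          * Cgd gam (alpha - /2 - delta) tau)
       * mubar c.
Proof.
move=> alpha1 gam_bound _.
set k1 := \big[Rplus/0]_(j < d) (2 * tail_cst (2 * alpha) * Rpower (gam j) (/ (2 * alpha) - 1))
     * full_cst (2 * alpha) ^ d.
have a2 : 1 < 2 * alpha by lra.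
have k1_ge0 : 0 <= k1.
  apply: Rmult_le_pos.
    apply: big_Rplus_ge0 => j _; have := tail_cst_gt0 a2.
    have := Rpower_gt0 (gam j) (/ (2 * alpha) - 1); nra.
  by apply: pow_le; have := full_cst_ge1 a2; lra.
set k2 := product_cst alpha gam.
have s1 := sqrt_pos k1; have s2 := sqrt_pos k2.
(* Neither [k1] nor [k2] involves [delta] or [tau]; the 1 gives positivity from two nonnegative
   roots. *)
exists (sqrt k1 + sqrt k2 + 1); split; first lra.
move=> delta tau g N xs c L gen nu hdelta htau g_inH N0 xs_cube L_prime _ hwce nu1.
set beta := alpha - / 2 - delta in hwce *.
have mu0 := mubar_ge0 c N0.
have g0 : 0 <= normH alpha gam g by exact: sqrt_pos.
have Y0 := Rpower_gt0 nu (/ (2 * alpha) - 1).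
have B0 : 0 <= k1 * Rpower nu (/ (2 * alpha) - 1) by apply: Rmult_le_pos; lra.
have E1 := err1_bound alpha1 gam_bound nu1 g_inH c N0 xs_cube B0
  (inK_compl_weight_sum alpha1 gam_bound nu1).
have W0 := Rmult_lt_0_compat _ _ (Cgd_gt0 gam beta tau) (Rpower_gt0 (INR L) (- beta + tau)).
(* The lattice hypothesis is used at tau' = tau only, admissible since alpha - 1 - delta = beta -
   1/2. *)
have htau' : 0 < tau <= beta - / 2 by rewrite /beta; lra.
have E2 := err2_bound alpha1 gam_bound nu1 (ltac:(rewrite /beta; lra) : 0 < beta)
  (ltac:(rewrite /beta; lra) : beta <= alpha - / 2) g_inH xs c N0
  (Rlt_le _ _ W0) (hwce _ htau').
rewrite -/k2 in E2.
have sY : sqrt (k1 * Rpower nu (/ (2 * alpha) - 1)) = sqrt k1 * / Rpower nu (/ 2 - / (4 * alpha)).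
  rewrite sqrt_mult; [|lra|lra]; congr Rmult.
  rewrite -Rpower_sqrt // Rpower_mult -Rpower_Ropp; congr Rpower; field; lra.
rewrite sY in E1.
have eL : - beta + tau = - (beta - tau) by ring.
rewrite eL Rpower_Ropp in E2.
set V := / Rpower nu (/ 2 - / (4 * alpha)) in E1 *.
have V0 : 0 < V by apply: Rinv_0_lt_compat; exact: Rpower_gt0.
set X := Rpower nu ((/ 2 + / (4 * alpha)) * INR d) in E2 *.
have X0 : 0 < X by exact: Rpower_gt0.
set l := Rpower (INR L) (beta - tau) in E2 *.
have l0 : 0 < / l by apply: Rinv_0_lt_compat; exact: Rpower_gt0.
set K := Cgd gam beta tau in E2 *.
have K0 : 0 < K by exact: Cgd_gt0.
have cz : 1 <= cagd alpha gam * zetadd delta d.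
  by have := cagd_ge1 alpha gam; have := zetadd_ge1 delta d; nra.
set Q := X / l * cagd alpha gam * zetadd delta d * K.
have Q0 : 0 < X * / l * K by apply: Rmult_lt_0_compat => //; apply: Rmult_lt_0_compat.
have hQ : X * / l * K <= Q.
  have -> : Q = cagd alpha gam * zetadd delta d * (X * / l * K) by rewrite /Q /Rdiv; ring.
  nra.
set m := normH alpha gam g * mubar c.
have m0 : 0 <= m by exact: Rmult_le_pos.
have {}E1 : err1 alpha nu gam xs c g <= m * (sqrt k1 * V).
  by apply: Rle_trans E1 _; rewrite /m; lra.
have {}E2 : err2 L alpha nu gam xs c gen g <= m * (sqrt k2 * Q).
  apply: Rle_trans E2 _.
  have -> : sqrt k2 * X * normH alpha gam g * mubar c * (K * / l) =
    m * (sqrt k2 * (X * / l * K)) by rewrite /m; ring.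
  by do 2!apply: Rmult_le_compat_l => //.
have -> : (sqrt k1 + sqrt k2 + 1) * normH alpha gam g * (V + Q) * mubar c =
  m * ((sqrt k1 + sqrt k2 + 1) * (V + Q)) by rewrite /m; ring.
apply: Rle_trans (Rplus_le_compat _ _ _ _ E1 E2) _.
rewrite -Rmult_plus_distr_l; apply: Rmult_le_compat_l => //; nra.
Qed.
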